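(* Let $\mathcal{A}$ and $\mathcal{B}$ be unital $C^*$-algebras such that $\mathcal{B}$ is a Banach bimodule over $\mathcal{A}$, and let $\delta:\mathcal{A}\supset\mathrm{Dom}(\delta)\to\mathcal{B}$ be a densely defined $*$-derivation with $\ker\delta=\mathbb{C}I$, such that the image of $\{a\in\mathrm{Dom}(\delta):\|\delta(a)\|\le1\}$ in $\mathcal{A}/\mathbb{C}I$ is bounded. Let $\mathcal{S}$ be the state space of $\mathcal{A}$ with the metric $$L(\varphi_1,\varphi_2)=\sup\{|\varphi_1(a)-\varphi_2(a)|:a\in\mathrm{Dom}(\delta),\ \|\delta(a)\|\le1\}.$$ Let $\phi_1,\dots,\phi_d$ be unital $*$-endomorphisms of $\mathcal{A}$, $d\ge2$, and assume that for each $i$ the restriction $\gamma_i$ to $\mathcal{S}$ of the Banach space adjoint $\phi_i^*:\mathcal{A}^*\to\mathcal{A}^*$ is a proper contraction with respect to $L$. Then the endomorphism crossed product $C^*$-algebra $C^*(\mathcal{A};\phi_1,\dots,\phi_d)$ is canonically isomorphic to the Cuntz algebra $\mathcal{O}_d$ (it coincides with its $C^*$-subalgebra generated by the canonical isometries $S_1,\dots,S_d$) and has a unique KMS state, at inverse temperature $\log d$.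
   Context: $C^*(\mathcal{A};\phi_1,\dots,\phi_d)$ is the universal $C^*$-algebra generated by the image of a $*$-homomorphism $\pi$ of $\mathcal{A}$ and by the Cuntz algebra $\mathcal{O}_d$ with generators $S_1,\dots,S_d$ (isometries with $\sum_iS_iS_i^*=I$), subject to the relations $\pi(a)S_i=S_i\pi(\phi_i(a))$ for $a\in\mathcal{A}$, $i=1,\dots,d$. KMS states are with respect to the one-parameter group $\alpha_t=\gamma_{e^{it}}$ where $\gamma$ is the canonical gauge action, $\gamma_z(S_i)=zS_i$, $\gamma_z(\pi(a))=\pi(a)$: a state $\omega$ is KMS at inverse temperature $\beta$ if $\omega(a\alpha_{i\beta}(b))=\omega(ba)$ for all $a,b$ in a dense $*$-subalgebra of entire elements for $\alpha$. A proper contraction with respect to $L$ is a map with Lipschitz constant $<1$. The boundedness hypothesis on $\delta$ is equivalent to $L$ being a bounded metric on $\mathcal{S}$. *)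

(* Defs.v *)
From HB Require Import structures.
From mathcomp Require Import all_boot all_order all_algebra.
From mathcomp Require Import complex.
From mathcomp Require Import all_classical all_reals all_analysis.

Set Implicit Arguments.
Unset Strict Implicit.
Unset Printing Implicit Defensive.
Import Order.TTheory GRing.Theory Num.Theory.
Import numFieldNormedType.Exports.

Local Open Scope classical_set_scope.
Local Open Scope complex_scope.
Local Open Scope ring_scope.

(* Unital complex C*-algebras, nontrivial as all rings of the hierarchy are.
   The norm of a normed module over R[i] takes its values in R[i] (in fact in
   the nonnegative reals of R[i]). The hierarchy has no room for a common
   extension of normed modules and algebras, so the product is introduced
   here and the algebra structure is declared on top of it as an instance. *)
HB.mixin Record isCStarAlgebra (R : realType) A
    of CompleteNormedModule R[i] A := {
  cstar_one : A ;
  cstar_mul : A -> A -> A ;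
  star : A -> A ;
  cstar_mulA : associative cstar_mul ;
  cstar_mul1l : left_id cstar_one cstar_mul ;
  cstar_mul1r : right_id cstar_one cstar_mul ;
  cstar_mulDl : left_distributive cstar_mul +%R ;
  cstar_mulDr : right_distributive cstar_mul +%R ;
  cstar_one_neq0 : cstar_one != 0 ;
  cstar_mulZl : forall (k : R[i]) a b,
    k *: cstar_mul a b = cstar_mul (k *: a) b ;
  cstar_mulZr : forall (k : R[i]) a b,
    k *: cstar_mul a b = cstar_mul a (k *: b) ;
  starD : forall a b, star (a + b) = star a + star b ;
  starZ : forall (k : R[i]) a, star (k *: a) = k^* *: star a ;
  starM : forall a b, star (cstar_mul a b) = cstar_mul (star b) (star a) ;
  starK : involutive star ;
  cstar_normM : forall a b : A, `|cstar_mul a b| <= `|a| * `|b| ;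
  cstar_norm : forall a : A, `|cstar_mul (star a) a| = `|a| ^+ 2
}.

#[short(type="cstarAlgType")]
HB.structure Definition CStarAlgebra (R : realType) :=
  {A of CompleteNormedModule R[i] A & isCStarAlgebra R A}.

#[non_forgetful_inheritance]
HB.instance Definition _ (R : realType) (A : cstarAlgType R) :=
  GRing.Zmodule_isNzRing.Build A (@cstar_mulA R A) (@cstar_mul1l R A)
    (@cstar_mul1r R A) (@cstar_mulDl R A) (@cstar_mulDr R A)
    (@cstar_one_neq0 R A).

#[non_forgetful_inheritance]
HB.instance Definition _ (R : realType) (A : cstarAlgType R) :=
  GRing.Lmodule_isLalgebra.Build R[i] A (@cstar_mulZl R A).

#[non_forgetful_inheritance]
HB.instance Definition _ (R : realType) (A : cstarAlgType R) :=
  GRing.Lalgebra_isAlgebra.Build R[i] A (@cstar_mulZr R A).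

Section CStarAlgebraTheory.
Variables (R : realType) (A B : cstarAlgType R).

Record star_hom (f : A -> B) : Prop := StarHom {
  star_hom_linear : linear f ;
  star_hom_mul : {morph f : a b / a * b} ;
  star_hom_one : f 1 = 1 ;
  star_hom_star : {morph f : a / star a}
}.

Record star_subalgebra (D : set A) : Prop := StarSubalgebra {
  star_subalgebra0 : D 0 ;
  star_subalgebraD : forall a b, D a -> D b -> D (a + b) ;
  star_subalgebraZ : forall (k : R[i]) a, D a -> D (k *: a) ;
  star_subalgebraM : forall a b, D a -> D b -> D (a * b) ;
  star_subalgebra_star : forall a, D a -> D (star a)
}.

Definition cstar_generated (X : set A) : set A :=
  \bigcap_(D in [set D | [/\ star_subalgebra D, closed D & X `<=` D]]) D.

(* In R[i], 0 <= z means that z is real and nonnegative. *)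
Record is_state (w : A -> R[i]) : Prop := IsState {
  state_linear : scalar w ;
  state_ge0 : forall a, 0 <= w (star a * a) ;
  state1 : w 1 = 1
}.

(* The norm of the class of a in the quotient of A by the scalars. *)
Definition quotient_norm (a : A) : R :=
  inf [set complex.Re `|a - k%:A| | k in [set: R[i]]].

End CStarAlgebraTheory.

Section Derivation.
Variables (R : realType) (A B : cstarAlgType R).

(* The unit of A is not required to act as the identity of B. *)
Record banach_bimodule (la : A -> B -> B) (ra : B -> A -> B) : Prop :=
  BanachBimodule {
  bimod_linear_l : forall b, linear (fun a => la a b) ;
  bimod_linear_lr : forall a, linear (la a) ;
  bimod_linear_r : forall b, linear (ra b) ;
  bimod_linear_rl : forall a, linear (fun b => ra b a) ;
  bimod_mul_l : forall a a' b, la (a * a') b = la a (la a' b) ;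
  bimod_mul_r : forall a a' b, ra b (a * a') = ra (ra b a) a' ;
  bimod_assoc : forall a a' b, ra (la a b) a' = la a (ra b a') ;
  bimod_bounded : exists M : R[i], forall a b,
    `|la a b| <= M * `|a| * `|b| /\ `|ra b a| <= M * `|a| * `|b|
}.

(* d is a total function whose values outside Dom are irrelevant. *)
Record star_derivation (la : A -> B -> B) (ra : B -> A -> B)
    (Dom : set A) (d : A -> B) : Prop := StarDerivation {
  derivation_dom : star_subalgebra Dom ;
  derivation_dense : dense Dom ;
  derivationD : forall a b, Dom a -> Dom b -> d (a + b) = d a + d b ;
  derivationZ : forall (k : R[i]) a, Dom a -> d (k *: a) = k *: d a ;
  derivationM : forall a b, Dom a -> Dom b ->
    d (a * b) = la a (d b) + ra (d a) b ;
  derivation_star : forall a, Dom a -> d (star a) = star (d a)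
}.

Definition lipschitz_ball (Dom : set A) (d : A -> B) : set A :=
  [set a | Dom a /\ `|d a| <= 1].

Definition state_dist (Dom : set A) (d : A -> B) (w1 w2 : A -> R[i]) : \bar R :=
  ereal_sup [set (complex.Re `|w1 a - w2 a|)%:E | a in lipschitz_ball Dom d].

Definition proper_contraction (Dom : set A) (d : A -> B)
    (g : (A -> R[i]) -> (A -> R[i])) : Prop :=
  exists c : R, [/\ 0 <= c, c < 1 & forall w1 w2, is_state w1 -> is_state w2 ->
    (state_dist Dom d (g w1) (g w2) <= c%:E * state_dist Dom d w1 w2)%E].

End Derivation.

Section Cuntz.
Variables (R : realType) (n : nat).

Record cuntz_family (E : cstarAlgType R) (S : 'I_n -> E) : Prop :=
  CuntzFamily {
  cuntz_isometry : forall i, star (S i) * S i = 1 ;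
  cuntz_sum : \sum_i S i * star (S i) = 1
}.

(* Uniqueness of h in the universal property follows from generation. *)
Record is_cuntz_algebra (E : cstarAlgType R) (S : 'I_n -> E) : Prop :=
  IsCuntzAlgebra {
  cuntz_relations : cuntz_family S ;
  cuntz_generated : cstar_generated (range S) = setT ;
  cuntz_universal : forall (F : cstarAlgType R) (T : 'I_n -> F),
    cuntz_family T -> exists2 h : E -> F, star_hom h & forall i, h (S i) = T i
}.

Variables (A : cstarAlgType R) (phi : 'I_n -> A -> A).

(* p is unital (see star_hom): with a non-unital p the universal algebra would
   split off a further summand on which p vanishes. *)
Record covariant_pair (E : cstarAlgType R) (p : A -> E) (S : 'I_n -> E) :
    Prop := CovariantPair {
  covariant_hom : star_hom p ;
  covariant_cuntz : cuntz_family S ;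
  covariant_rel : forall i a, p a * S i = S i * p (phi i a)
}.

Record is_crossed_product (E : cstarAlgType R) (p : A -> E) (S : 'I_n -> E) :
    Prop := IsCrossedProduct {
  crossed_relations : covariant_pair p S ;
  crossed_generated : cstar_generated (range p `|` range S) = setT ;
  crossed_universal : forall (F : cstarAlgType R) (q : A -> F) (T : 'I_n -> F),
    covariant_pair q T ->
    exists h : E -> F, [/\ star_hom h, forall a, h (p a) = q a
                         & forall i, h (S i) = T i]
}.

Record is_gauge_action (E : cstarAlgType R) (p : A -> E) (S : 'I_n -> E)
    (g : R[i] -> E -> E) : Prop := IsGaugeAction {
  gauge_hom : forall z : R[i], `|z| = 1 -> star_hom (g z) ;
  gauge_gen : forall z : R[i], `|z| = 1 -> forall i, g z (S i) = z *: S i ;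
  gauge_fix : forall z : R[i], `|z| = 1 -> forall a, g z (p a) = p a
}.

End Cuntz.

Section KMS.
Variables (R : realType) (E : cstarAlgType R).

Definition gauge_flow (g : R[i] -> E -> E) (t : R) : E -> E :=
  g (cos t +i* sin t).

(* Entire functions C -> E as sums of everywhere convergent power series. *)
Definition entire (f : R[i] -> E) : Prop :=
  exists c : nat -> E, forall z : R[i],
    series (fun k => z ^+ k *: c k) @ \oo --> f z.

Definition entire_extension (alpha : R -> E -> E) (b : E) (f : R[i] -> E) :
    Prop :=
  entire f /\ forall t : R, f t%:C = alpha t b.

(* f ('i * beta) below is alpha_{i beta}(b); the entire extension f of
   t |-> alpha t b is unique by the identity theorem. As in Bratteli-Robinson
   (Definition 5.3.1), the dense *-subalgebra D of entire elements is also
   invariant under alpha. *)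
Record is_kms (alpha : R -> E -> E) (beta : R) (w : E -> R[i]) : Prop := IsKMS {
  kms_state : is_state w ;
  kms_condition : exists D : set E,
    [/\ star_subalgebra D, dense D,
        forall t a, D a -> D (alpha t a) &
        forall b, D b -> exists2 f, entire_extension alpha b f &
          forall a, D a -> w (a * f (0 +i* beta)) = w (b * a)]
}.

End KMS.

(* Main.v *)
(* A contraction iterated along long words m makes all states take nearly the same
   value on phi_m(a), hence phi_m(a) is close to a scalar. Since
   p(a) = sum_m S_m p(phi_m(a)) S_m^*, over the words m of a given length, p(a) is a
   norm limit of linear combinations of the S_m S_m^*; so E is generated by the
   S_i. The same sums in any Cuntz algebra O define a homomorphism from A to O, and the
   universal property of E then inverts the canonical map O -> E.

   The KMS state comes from the mean Psi(x) = (1/d) sum_i S_i^* x S_i: it lowers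
   S_i x S_j^* to a multiple of x and rotates a word S_m while dividing it by d, so
   Psi^N(x) converges in norm to a scalar w(x). Any KMS state w' satisfies
   w'(S_i a) = exp(-beta) w'(a S_i); summing over i gives beta = log d, so w' is
   invariant under Psi and equals w.

   The existence of enough states rests on the positivity of a^* a, proved with
   square roots obtained by a fixed point argument, and on a Hahn-Banach theorem
   proved by minimal sublinear functionals. *)

Require Import Defs.
From HB Require Import structures.
From mathcomp Require Import all_boot all_order all_algebra.
From mathcomp Require Import complex.
From mathcomp Require Import all_classical all_reals all_analysis.
From mathcomp Require Import ring lra.
From Stdlib Require Ncring Ncring_tac ZArith Algebra_syntax.

Set Implicit Arguments.
Unset Strict Implicit.
Unset Printing Implicit Defensive.
Import Order.TTheory GRing.Theory Num.Theory.
Import numFieldNormedType.Exports.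

Local Open Scope classical_set_scope.
Local Open Scope complex_scope.
Local Open Scope ring_scope.

(** Spectra and functional calculus are replaced by two devices. Roots are taken in the bicommutant
    of their argument, so that roots of commuting elements commute. Norm bounds rest on one
    algebraic certificate: commuting self-adjoint k and m with k^2 + m^2 = 1 have norm at most 1.
    Sums over words are block diagonal, so an estimate for such a sum is that of its worst block,
    whatever the number of words. The obstacle in the uniqueness of the KMS state is that the
    condition is given on some dense star subalgebra D, which need not contain the S_i, while b ->
    alpha_{i beta}(b) need not be bounded; approximating S_i from D thus says nothing about alpha_{i
    beta}(S_i). The remedy is the projection P onto gauge degree 1, a norm limit of finite averages
    of the flow. Averages of elements of D stay in D, and on the range of P the map alpha_{i beta}
    is multiplication by exp(-beta), which is bounded; density then gives the relation for S_i. *)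

#[export] Instance nzRing_ncring_ops (A : nzRingType) :
  @Ncring.Ring_ops A 0 1 +%R *%R (fun x y => x - y) -%R eq := {}.
#[export] Instance nzRing_ncring (A : nzRingType) :
  @Ncring.Ring A 0 1 +%R *%R (fun x y => x - y) -%R eq (nzRing_ncring_ops A).
Proof.
constructor.
- split; [by move=> x | by move=> x y -> | by move=> x y z -> ->].
- by move=> ? ? -> ? ? ->.
- by move=> ? ? -> ? ? ->.
- by move=> ? ? -> ? ? ->.
- by move=> ? ? ->.
- exact: (@add0r A).
- exact: (@addrC A).
- exact: (@addrA A).
- exact: (@mul1r A).
- exact: (@mulr1 A).
- exact: (@mulrA A).
- exact: (@mulrDl A).
- exact: (fun x y z => @mulrDr A z x y).
- by [].
- exact: (@subrr A).
Defined.

Ltac ncring := match goal with |- @eq ?T ?x ?y =>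
  change (@Algebra_syntax.equality T (@eq T) x y); Ncring_tac.non_commutative_ring end.

(** * Real-valued norms, limits and closures *)

Section RealNorm.
Variables (R : realType) (V : normedModType R[i]).
Implicit Types (x y z : V) (k : R[i]) (e t : R) (u v : nat -> V).

(** The norm has values in [R[i]], whose order is partial; its real part loses nothing by [nmE] and
    brings the estimates within reach of [lra] and [nra]. *)
Definition nm (W : normedZmodType R[i]) (x : W) : R := complex.Re `|x|.

Lemma nmE (W : normedZmodType R[i]) (x : W) : `|x| = (nm x)%:C.
Proof. by rewrite /nm RRe_real // ger0_real. Qed.

Lemma nm_ge0 (W : normedZmodType R[i]) (x : W) : 0 <= nm x.
Proof. by rewrite -ler0c -nmE. Qed.

Lemma nm0 (W : normedZmodType R[i]) : nm (0 : W) = 0.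
Proof. by rewrite /nm normr0. Qed.

Lemma nm_eq0 (W : normedZmodType R[i]) (x : W) : nm x = 0 -> x = 0.
Proof. by move=> h; apply/eqP; rewrite -normr_eq0 nmE h. Qed.

Lemma nmN (W : normedZmodType R[i]) (x : W) : nm (- x) = nm x.
Proof. by rewrite /nm normrN. Qed.

Lemma nmD (W : normedZmodType R[i]) (x y : W) : nm (x + y) <= nm x + nm y.
Proof. by rewrite -lecR rmorphD /= -!nmE ler_normD. Qed.

Lemma nmB (W : normedZmodType R[i]) (x y : W) : nm (x - y) <= nm x + nm y.
Proof. by rewrite -(nmN y) nmD. Qed.

Lemma nmC (W : normedZmodType R[i]) (x y : W) : nm (x - y) = nm (y - x).
Proof. by rewrite -nmN opprB. Qed.

Lemma nm_triangle (W : normedZmodType R[i]) (y x z : W) :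
  nm (x - z) <= nm (x - y) + nm (y - z).
Proof. by apply: le_trans (nmD _ _); rewrite addrA subrK. Qed.

Lemma nmZ k x : nm (k *: x) = nm k * nm x.
Proof. by apply: complexI; rewrite rmorphM /= -!nmE normrZ. Qed.

Lemma nmcR t : nm t%:C = `|t|.
Proof. by rewrite /nm normc_def /= expr0n /= addr0 sqrtr_sqr. Qed.

Lemma nmZr t x : nm (t%:C *: x) = `|t| * nm x.
Proof. by rewrite nmZ nmcR. Qed.

Lemma nmcM (k l : R[i]) : nm (k * l) = nm k * nm l.
Proof. by apply: complexI; rewrite rmorphM /= -!nmE normrM. Qed.

Lemma nmci : nm ('i : R[i]) = 1.
Proof. by rewrite /nm normc_def /= expr0n expr1n add0r sqrtr1. Qed.

Lemma le_eps t s : (forall e, 0 < e -> t <= s + e) -> t <= s.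
Proof. by move=> h; apply/ler_addgt0Pr. Qed.

(** Filter convergence restated with real radii and weak inequalities; [tends_cvg] is the
    dictionary. *)
Definition tends u x := forall e, 0 < e ->
  exists N, forall n, (N <= n)%N -> nm (u n - x) <= e.

Lemma tends_cst x : tends (fun=> x) x.
Proof. by move=> e e0; exists 0%N => n _; rewrite subrr nm0 ltW. Qed.

Lemma tends_eq u v x : (forall n, u n = v n) -> tends u x -> tends v x.
Proof. by move=> /funext ->. Qed.

Lemma tendsD u v x y : tends u x -> tends v y -> tends (fun n => u n + v n) (x + y).
Proof.
move=> hu hv e e0.
have e2 : 0 < e / 2 by rewrite divr_gt0.
have [N hN] := hu _ e2; have [M hM] := hv _ e2.
exists (maxn N M) => n; rewrite geq_max => /andP[/hN h1 /hM h2].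
rewrite opprD addrACA (le_trans (nmD _ _))//; lra.
Qed.

Lemma tends_shift u x m : tends u x -> tends (fun n => u (n + m)%N) x.
Proof.
move=> hu e /hu[N hN]; exists N => n nN; apply: hN.
exact: leq_trans nN (leq_addr _ _).
Qed.

Lemma nm_tends_le u x y t : (exists N, forall n, (N <= n)%N -> nm (u n - y) <= t) ->
  tends u x -> nm (x - y) <= t.
Proof.
move=> [N hN] hu; apply: le_eps => e /hu[M hM].
apply: le_trans (nm_triangle (u (maxn N M)) _ _) _.
rewrite (addrC t); apply: lerD; last by apply: hN; apply: leq_maxl.
by rewrite nmC; apply: hM; apply: leq_maxr.
Qed.

Lemma tends_unique u x y : tends u x -> tends u y -> x = y.
Proof.
move=> hx hy; apply/eqP; rewrite -subr_eq0; apply/eqP/nm_eq0/eqP.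
rewrite eq_le nm_ge0 andbT; apply: le_eps => e e0; rewrite add0r.
by apply: nm_tends_le hx; apply: hy.
Qed.

Lemma nm_tends u x t : (forall n, nm (u n) <= t) -> tends u x -> nm x <= t.
Proof.
move=> h /(@nm_tends_le u x 0 t); rewrite subr0; apply.
by exists 0%N => n _; rewrite subr0.
Qed.

Definition adh (D : set V) x := forall e, 0 < e -> exists2 y, D y & nm (x - y) <= e.

Lemma ball_nm x y e : ball x e%:C y <-> nm (x - y) < e.
Proof. by rewrite -ball_normE /= nmE ltcR. Qed.

Lemma gt0_complex k : 0 < k -> exists2 e, 0 < e & k = e%:C.
Proof.
move=> k0; exists (complex.Re k); first by rewrite -ltcR RRe_real ?gtr0_real.
by rewrite RRe_real ?gtr0_real.
Qed.

Lemma closure_adh (D : set V) x : closure D x <-> adh D x.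
Proof.
split=> [h e e0|h B /nbhs_ballP[k /= /gt0_complex[e e0 ->]] hB].
  have [|y [Dy]] := h (ball x e%:C); first by apply: nbhsx_ballx; rewrite ltcR.
  by move=> /ball_nm /ltW; exists y.
have [|y Dy hy] := h (e / 2); first by rewrite divr_gt0.
exists y; split => //; apply: hB; apply/ball_nm; lra.
Qed.

Lemma closed_adh (D : set V) : closed D <-> forall x, adh D x -> D x.
Proof.
split=> [h x /closure_adh|h]; first exact: h.
by move=> x /closure_adh; apply: h.
Qed.

Lemma dense_adh (D : set V) : dense D <-> forall x, adh D x.
Proof.
split=> [h x e e0|h O [x Ox] oO].
  have [||y [/ball_nm hy Dy]] := h (ball x e%:C).
  - by exists x; apply: ballxx; rewrite ltcR.
  - by apply: ball_open; rewrite ltcR.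
  - by exists y => //; apply: ltW.
have : nbhs x O by apply: open_nbhs_nbhs.
move=> hO; have [y [Dy Oy]] := (closure_adh D x).2 (h x) O hO.
by exists y.
Qed.

Lemma adh_sub (D : set V) x : D x -> adh D x.
Proof. by move=> Dx e e0; exists x => //; rewrite subrr nm0 ltW. Qed.

Lemma adh_adh (D : set V) x : adh (adh D) x -> adh D x.
Proof.
move=> h e e0; have e2 : 0 < e / 2 by rewrite divr_gt0.
have [y /(_ _ e2)[z Dz yz] xy] := h _ e2.
exists z => //; apply: le_trans (nm_triangle y _ _) _; lra.
Qed.

Lemma adh_tends (D : set V) u x : (forall n, D (u n)) -> tends u x -> adh D x.
Proof.
move=> h hu e /hu[N hN]; exists (u N) => //; rewrite nmC; exact: hN.
Qed.

Lemma tends_cvg u x : (u @ \oo --> x) <-> tends u x.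
Proof.
split=> [/cvgrPdist_le h e e0|h].
  have /h[N _ hN] : 0 < e%:C :> R[i] by rewrite ltcR.
  exists N => n /hN /=; by rewrite nmE lecR nmC.
apply/cvgrPdist_le => k /gt0_complex[e e0 ->].
have [N hN] := h _ e0; exists N => // n /hN /=.
by rewrite nmE lecR nmC.
Qed.

End RealNorm.

Definition cauchy_nm (R : realType) (V : normedModType R[i]) (u : nat -> V) :=
  forall e, 0 < e -> exists N, forall n m, (N <= n)%N -> nm (u (n + m)%N - u n) <= e.

Lemma tends_complete (R : realType) (V : completeNormedModType R[i]) (u : nat -> V) :
  cauchy_nm u -> exists x, tends u x.
Proof.
move=> hu; suff : cvgn u by move=> h; exists (limn u); apply/tends_cvg.
apply/cauchy_cvgP/cauchy_ballP => k /gt0_complex[e e0 ->].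
have e4 : 0 < e / 4 by rewrite divr_gt0.
have [N hN] := hu _ e4.
have h z : (N <= z)%N -> nm (u z - u N) <= e / 4.
  by move=> Nz; rewrite -(subnKC Nz); apply: hN.
pose B := [set x | nm (x - u N) <= e / 4].
exists (B, B) => /=; first by split; exists N.
move=> [x y] [/= h1 h2]; apply/ball_nm.
apply: le_lt_trans (nm_triangle (u N) _ _) _.
rewrite /B /= nmC in h2; rewrite /B /= in h1; lra.
Qed.

Lemma geometric_small (R : realType) (K r e : R) : 0 <= r -> r < 1 -> 0 < e ->
  exists N, forall n, (N <= n)%N -> K * r ^+ n <= e.
Proof.
move=> r0 r1 e0.
have h : (geometric K r) @ \oo --> (0 : R) by apply: cvg_geometric; rewrite ger0_norm.
move/cvgrPdist_le/(_ _ e0): h => [N _ hN]; exists N => n /hN /=.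
by rewrite sub0r normrN => h; apply: le_trans h; rewrite ler_norm.
Qed.

(** * The contraction principle on a closed set *)

Section BanachFixpoint.
Variables (R : realType) (V : completeNormedModType R[i]).
Variables (D : set V) (f : V -> V) (r : R) (x0 : V).

Lemma contraction_fixpoint : 0 <= r -> r < 1 ->
  (forall x, adh D x -> D x) -> D x0 -> (forall x, D x -> D (f x)) ->
  (forall x y, D x -> D y -> nm (f x - f y) <= r * nm (x - y)) ->
  exists2 x, D x & f x = x.
Proof.
move=> r0 r1 clD Dx0 Df hf; pose u n := iter n f x0.
have Du n : D (u n) by elim: n => //= n; apply: Df.
have hstep n : nm (u n.+1 - u n) <= nm (f x0 - x0) * r ^+ n.
  elim: n => [|n IH]; first by rewrite expr0 mulr1.
  apply: le_trans (hf _ _ (Du n.+1) (Du n)) _.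
  by rewrite exprS mulrCA ler_wpM2l.
set C := nm (f x0 - x0) in hstep.
have r1' : 0 < 1 - r by rewrite subr_gt0.
(* The geometric sum is kept in telescoped form, so that the induction on [m] closes by an
   identity. *)
have hsum n m : nm (u (n + m)%N - u n) <= C / (1 - r) * (r ^+ n - r ^+ (n + m)).
  elim: m => [|m IH]; first by rewrite addn0 !subrr nm0 mulr0.
  rewrite addnS; apply: le_trans (nm_triangle (u (n + m)%N) _ _) _.
  apply: le_trans (lerD (hstep _) IH) _.
  rewrite le_eqVlt; apply/orP; left; apply/eqP.
  rewrite exprS; field; lra.
have [x hx] : exists x, tends u x.
  apply: tends_complete => e e0.
  have [N hN] := geometric_small (C / (1 - r)) r0 r1 e0.
  exists N => n m /hN h; apply: le_trans (hsum _ _) _; apply: le_trans h.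
  rewrite ler_wpM2l ?gerBl ?exprn_ge0// divr_ge0 ?nm_ge0// ltW//.
have Dx : D x by apply/clD/(adh_tends Du).
exists x => //; apply: (@tends_unique _ _ (fun n => u (n + 1)%N)); last exact: tends_shift.
move=> e /hx[N hN]; exists N => n /hN h; rewrite addn1.
apply: le_trans (hf _ _ (Du n) Dx) _.
by apply: le_trans h; rewrite ler_piMl ?nm_ge0// ltW.
Qed.

End BanachFixpoint.

(** * Elementary C*-algebra: adjoints, norms, continuity of the product *)

Section CStarBasics.
Variables (R : realType) (A : cstarAlgType R).
Implicit Types (a b x y z : A) (k : R[i]) (t s e : R).

Lemma nmM a b : nm (a * b) <= nm a * nm b.
Proof. by rewrite -lecR rmorphM /= -!nmE cstar_normM. Qed.

Lemma nm_cstar a : nm (star a * a) = nm a ^+ 2.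
Proof. by apply: complexI; rewrite rmorphXn /= -!nmE cstar_norm. Qed.

Lemma starDr a b : star (a + b) = star a + star b.
Proof. exact: starD. Qed.

Lemma starZc k a : star (k *: a) = conjc k *: star a.
Proof. exact: starZ. Qed.

Lemma star0 : star (0 : A) = 0.
Proof. by apply: (addIr (star 0)); rewrite -starDr !add0r. Qed.

Lemma starN a : star (- a) = - star a.
Proof. by apply: (addIr (star a)); rewrite -starDr !addNr star0. Qed.

Lemma starB a b : star (a - b) = star a - star b.
Proof. by rewrite starDr starN. Qed.

Lemma starMr a b : star (a * b) = star b * star a.
Proof. exact: starM. Qed.

Lemma star1 : star (1 : A) = 1.
Proof. by rewrite -[LHS]mulr1 -[X in _ * X]starK -starMr mulr1 starK. Qed.

Lemma starZr t a : star (t%:C *: a) = t%:C *: star a.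
Proof. by rewrite starZc conjc_real. Qed.

Lemma star_sum (I : finType) (F : I -> A) : star (\sum_i F i) = \sum_i star (F i).
Proof. by apply: (big_morph star starDr star0). Qed.

Lemma nm1 : nm (1 : A) = 1.
Proof.
have := nm_cstar 1; rewrite star1 mulr1 expr2 => h.
have n0 : nm (1 : A) != 0 by apply/eqP => /nm_eq0 /eqP; rewrite oner_eq0.
by apply: (mulfI n0); rewrite -h mulr1.
Qed.

Lemma nm_star_le a : nm a <= nm (star a).
Proof.
have [->|n0] := eqVneq (nm a) 0; first exact: nm_ge0.
have a0 : 0 < nm a by rewrite lt_def n0 nm_ge0.
by rewrite -(ler_pM2r a0) -expr2 -nm_cstar nmM.
Qed.

Lemma nm_star a : nm (star a) = nm a.
Proof. by apply/eqP; rewrite eq_le nm_star_le -{2}(starK a) nm_star_le. Qed.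

Lemma nm_alg k : nm (k%:A : A) = nm k.
Proof. by rewrite nmZ nm1 mulr1. Qed.

Lemma nm_sum (I : finType) (F : I -> A) : nm (\sum_i F i) <= \sum_i nm (F i).
Proof.
elim/big_ind2 : _ => [|x1 x2 y1 y2 h1 h2|//]; first by rewrite nm0.
by apply: le_trans (nmD _ _) _; apply: lerD.
Qed.

Lemma nm_unitary (u : A) : star u * u = 1 -> nm u = 1.
Proof.
move=> h; have := nm_cstar u; rewrite h nm1 => /esym/eqP.
by rewrite sqrf_eq1 => /orP[/eqP//|/eqP h1]; have := nm_ge0 u; rewrite h1; lra.
Qed.

Lemma tendsM (u v : nat -> A) x y :
  tends u x -> tends v y -> tends (fun n => u n * v n) (x * y).
Proof.
move=> hu hv e e0; pose K := nm x + nm y + 1.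
have K0 : 0 < K by rewrite /K; have := nm_ge0 x; have := nm_ge0 y; lra.
pose d := Num.min 1 (e / (2 * K)).
have d0 : 0 < d by rewrite lt_min ltr01 divr_gt0// mulr_gt0.
have [N hN] := hu _ d0; have [M hM] := hv _ d0.
exists (maxn N M) => n; rewrite geq_max => /andP[/hN h1 /hM h2].
have -> : u n * v n - x * y = (u n - x) * v n + x * (v n - y).
  by rewrite mulrBl mulrBr addrA subrK.
apply: le_trans (nmD _ _) _.
have d1 : d <= 1 by rewrite ge_min lexx.
have dK : d * K <= e / 2.
  have : d <= e / (2 * K) by rewrite ge_min lexx orbT.
  by rewrite invfM mulrA ler_pdivlMr.
have hv1 : nm (v n) <= nm y + 1.
  by rewrite -(subrK y (v n)) addrC; apply: le_trans (nmD _ _) _; lra.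
have p1 : nm ((u n - x) * v n) <= d * (nm y + 1).
  by apply: le_trans (nmM _ _) _; apply: ler_pM; rewrite ?nm_ge0.
have p2 : nm (x * (v n - y)) <= nm x * d.
  by apply: le_trans (nmM _ _) _; rewrite ler_wpM2l ?nm_ge0.
apply: le_trans (lerD p1 p2) _; rewrite /K in dK.
have := nm_ge0 x; have := nm_ge0 y; nra.
Qed.

Lemma tends_star (u : nat -> A) x : tends u x -> tends (fun n => star (u n)) (star x).
Proof.
by move=> hu e /hu[N hN]; exists N => n /hN; rewrite -starB nm_star.
Qed.

End CStarBasics.

Lemma tends_lip (R : realType) (V W : normedModType R[i]) (f : V -> W) (K : R)
    (u : nat -> V) (x : V) : (forall x y, nm (f x - f y) <= K * nm (x - y)) ->
  tends u x -> tends (fun n => f (u n)) (f x).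
Proof.
move=> hf hu e e0.
(* No sign is assumed of [K], hence the positive constant [|K| + 1]. *)
have K0 : 0 < `|K| + 1 by apply: ltr_wpDl.
have [N hN] := hu (e / (`|K| + 1)) (divr_gt0 e0 K0).
exists N => n /hN h; apply: le_trans (hf _ _) _.
move: h; rewrite ler_pdivlMr// => h; apply: le_trans h; rewrite mulrC ler_wpM2l ?nm_ge0//.
by apply: le_trans (ler_norm _) _; rewrite lerDl.
Qed.

Lemma tendsZ (R : realType) (V : normedModType R[i]) (k : R[i]) (u : nat -> V) (x : V) :
  tends u x -> tends (fun n => k *: u n) (k *: x).
Proof. by apply: (@tends_lip _ _ _ _ (nm k)) => y z; rewrite -scalerBr nmZ. Qed.

Lemma adh_seq (R : realType) (V : normedModType R[i]) (D : set V) (x : V) :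
  adh D x -> exists2 u : nat -> V, (forall n, D (u n)) & tends u x.
Proof.
move=> h; have h' n : exists y, D y /\ nm (x - y) <= n.+1%:R^-1.
  by have [|y Dy hy] := h n.+1%:R^-1; [rewrite invr_gt0 ltr0n | exists y].
have [u hu] := choice h'; exists u => [n|]; first exact: (hu n).1.
move=> e e0; exists (Num.truncn e^-1) => n hn.
rewrite nmC; apply: le_trans (hu n).2 _.
rewrite -[leRHS]invrK lef_pV2 ?posrE ?invr_gt0 ?ltr0n//.
apply: ltW; apply: lt_le_trans (truncnS_gt _) _.
by rewrite ler_nat.
Qed.

Lemma divr2_gt0 (R : realType) (e : R) : 0 < e -> 0 < e / 2.
Proof. by move=> e0; rewrite divr_gt0. Qed.

(** * The positive cone and square roots *)

Section Positivity.
Variables (R : realType) (A : cstarAlgType R).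
Implicit Types (a b c x y z u v : A) (t s e : R).

Local Notation "t %:A'" := (t%:C *: (1 : A)) (at level 2, format "t %:A'").

Lemma scrD t s : (t + s)%:A' = t%:A' + s%:A'.
Proof. by rewrite rmorphD scalerDl. Qed.

Lemma scrB t s : (t - s)%:A' = t%:A' - s%:A'.
Proof. by rewrite rmorphB scalerBl. Qed.

Lemma scr_mull t x : t%:A' * x = t%:C *: x.
Proof. by rewrite -scalerAl mul1r. Qed.

Lemma scr_mulr t x : x * t%:A' = t%:C *: x.
Proof. by rewrite -scalerAr mulr1. Qed.

Lemma star_scr t : star t%:A' = t%:A'.
Proof. by rewrite starZr star1. Qed.

Lemma scalerr t s x : t%:C *: (s%:C *: x) = (t * s)%:C *: x.
Proof. by rewrite scalerA rmorphM. Qed.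

Lemma nm_scr t : nm t%:A' = `|t|.
Proof. by rewrite nm_alg nmcR. Qed.

(** Membership of [y] in the bicommutant of [x], the one trace of functional calculus that is
    kept. *)
Definition bicomm x y := forall b, b * x = x * b -> b * y = y * b.

(** The equation (1 - y)^2 = 1 - x is the fixed point equation y = (x + y^2) / 2. On the ball of
    radius nm x the right-hand side has Lipschitz constant nm x, and self-adjointness and the
    bicommutant condition cut out a closed invariant subset, so the fixed point inherits them. *)
Lemma sqrt1B x : star x = x -> nm x < 1 ->
  exists y, [/\ star y = y, bicomm x y, nm y <= nm x & (1 - y) * (1 - y) = 1 - x].
Proof.
move=> sx x1.
pose D := [set y | [/\ star y = y, bicomm x y & nm y <= nm x]].
pose f y := (2^-1)%:C *: (x + y * y).
have h2 : `|2^-1| = 2^-1 :> R by rewrite ger0_norm.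
have [y [sy cy ny] fy] : exists2 y, D y & f y = y.
  apply: (contraction_fixpoint (r := nm x) (x0 := 0) (nm_ge0 x) x1).
  - move=> y /adh_seq[w hw wy]; split.
    + apply: (tends_unique _ wy); apply: (tends_eq _ (tends_star wy)) => n.
      by have [] := hw n.
    + move=> b bx; apply: (@tends_unique _ _ (fun n => b * w n)).
        by apply: tendsM wy; apply: tends_cst.
      apply: (tends_eq (u := fun n => w n * b)).
        by move=> n; have [_ /(_ _ bx) -> _] := hw n.
      by apply: tendsM wy _; apply: tends_cst.
    + by apply: nm_tends wy => n; have [] := hw n.
  - by split; rewrite ?star0 ?nm0 ?nm_ge0// => b _; rewrite mulr0 mul0r.
  - move=> y [sy cy ny]; split.
    + by rewrite /f starZr starDr starMr sx sy.
    + move=> b bx; rewrite /f -scalerAl -scalerAr mulrDl mulrDr bx.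
      by rewrite mulrA (cy _ bx) -mulrA (cy _ bx) mulrA.
    + rewrite /f nmZr h2; have := nmD x (y * y); have := nmM y y.
      have := nm_ge0 y; have := nm_ge0 x; nra.
  - move=> y1 y2 [_ _ ny1] [_ _ ny2]; rewrite /f -scalerBr nmZr h2.
    have -> : x + y1 * y1 - (x + y2 * y2) = y1 * (y1 - y2) + (y1 - y2) * y2 by ncring.
    have := nmD (y1 * (y1 - y2)) ((y1 - y2) * y2).
    have := nmM y1 (y1 - y2); have := nmM (y1 - y2) y2.
    have := nm_ge0 (y1 - y2); nra.
exists y; split => //.
have : y + y = x + y * y.
  rewrite -{1 2}fy /f -scalerDl -rmorphD /=.
  by rewrite (_ : 2^-1 + 2^-1 = 1) ?scale1r//; lra.
move=> h; have -> : (1 - y) * (1 - y) = 1 + y * y - (y + y) by ncring.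
by rewrite h; ncring.
Qed.

(** The Neumann series in fixed point form: y = 1 + (1 - x) y gives a right inverse, the mirrored
    equation a left one, and the two coincide. *)
Lemma inv_near1 x : nm (1 - x) < 1 -> exists y, x * y = 1 /\ y * x = 1.
Proof.
move=> x1.
have [y _ hy] : exists2 y, setT y & 1 + (1 - x) * y = y.
  apply: (contraction_fixpoint (r := nm (1 - x)) (x0 := 0) (nm_ge0 _) x1) => // y z _ _.
  have -> : 1 + (1 - x) * y - (1 + (1 - x) * z) = (1 - x) * (y - z) by ncring.
  exact: nmM.
have [z _ hz] : exists2 y, setT y & 1 + y * (1 - x) = y.
  apply: (contraction_fixpoint (r := nm (1 - x)) (x0 := 0) (nm_ge0 _) x1) => // u v _ _.
  have -> : 1 + u * (1 - x) - (1 + v * (1 - x)) = (u - v) * (1 - x) by ncring.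
  by rewrite mulrC nmM.
have xy : x * y = 1.
  have -> : x * y = 1 + y - (1 + (1 - x) * y) by ncring.
  by rewrite hy addrK.
have zx : z * x = 1.
  have -> : z * x = 1 + z - (1 + z * (1 - x)) by ncring.
  by rewrite hz addrK.
exists y; split => //.
by have -> : y = z by rewrite -[y]mul1r -zx -mulrA xy mulr1.
Qed.

(* k + i m is unitary, and k is the mean of this unitary and its adjoint. *)
Lemma nm_le1_sum_sqr (k m : A) : star k = k -> star m = m -> k * m = m * k ->
  k * k + m * m = 1 -> nm k <= 1.
Proof.
move=> sk sm km h; pose u := k + 'i *: m; pose u' := k - 'i *: m.
have su : star u = u'.
  rewrite /u /u' starDr starZc sk sm; congr (_ + _).
  by rewrite -scaleNr; congr (_ *: _); apply/eqP; rewrite eq_complex /= oppr0 !eqxx.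
have uu : star u * u = 1.
  rewrite su /u /u'.
  have -> : (k - 'i *: m) * (k + 'i *: m) =
    k * k + k * ('i *: m) - 'i *: m * k - ('i *: m) * ('i *: m) by ncring.
  rewrite -!scalerAl -!scalerAr km scalerA.
  have -> : 'i * 'i = -1 :> R[i].
    by apply/eqP; rewrite eq_complex /= !(mul0r, mulr0, mulr1, mul1r, add0r, addr0, sub0r, oppr0) !eqxx.
  by rewrite scaleN1r opprK addrK.
have nu := nm_unitary uu.
have hk : 2%:C *: k = u + u'.
  by rewrite rmorph_nat scaler_nat mulr2n /u /u'; ncring.
have := nmD u u'; rewrite -hk nmZr ger0_norm// -su nm_star nu; lra.
Qed.

(* Usually positivity is ||t - x|| <= t for some t >= 0; the slack e makes the
   cone closed at once. *)
Definition pos x := star x = x /\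
  forall e, 0 < e -> exists2 t, 0 <= t & nm (t%:A' - x) <= t + e.

Lemma pos_sa x : pos x -> star x = x. Proof. by case. Qed.

Lemma pos_scr t : 0 <= t -> pos t%:A'.
Proof.
move=> t0; split=> [|e e0]; first exact: star_scr.
by exists t => //; rewrite subrr nm0; lra.
Qed.

Lemma posD x y : pos x -> pos y -> pos (x + y).
Proof.
move=> [sx hx] [sy hy]; split=> [|e e0]; first by rewrite starDr sx sy.
have e2 : 0 < e / 2 by rewrite divr_gt0.
have [t t0 ht] := hx _ e2; have [s s0 hs] := hy _ e2.
exists (t + s); first exact: addr_ge0.
rewrite scrD opprD addrACA; apply: le_trans (nmD _ _) _; lra.
Qed.

Lemma posZ t x : 0 <= t -> pos x -> pos (t%:C *: x).
Proof.
rewrite le_eqVlt => /orP[/eqP<- _|t0 [sx hx]]; first by rewrite scale0r -(scale0r 1); apply: pos_scr.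
split=> [|e e0]; first by rewrite starZr sx.
have [s s0 hs] := hx (e / t) (divr_gt0 e0 t0).
exists (t * s); first by rewrite mulr_ge0// ltW.
rewrite -scalerr -scalerBr nmZr gtr0_norm//.
by move: hs; rewrite -(ler_pM2l t0) mulrDr [t * (e / t)]mulrC divfK// gt_eqF.
Qed.

Lemma pos_sum (I : finType) (F : I -> A) : (forall i, pos (F i)) -> pos (\sum_i F i).
Proof.
move=> h; elim/big_ind : _ => //; last exact: posD.
by rewrite -(scale0r 1); apply: pos_scr.
Qed.

Lemma pos_adh x : adh pos x -> pos x.
Proof.
move=> hx; split=> [|e e0].
  apply/eqP; rewrite -subr_eq0; apply/eqP/nm_eq0/eqP; rewrite eq_le nm_ge0 andbT.
  apply: le_eps => e e0; rewrite add0r.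
  have [y [sy _] xy] := hx (e / 2) (divr2_gt0 e0).
  apply: le_trans (nm_triangle y _ _) _.
  have -> : nm (star x - y) = nm (x - y) by rewrite -{1}sy -starB nm_star.
  rewrite (nmC y); lra.
have [y [_ hy] xy] := hx (e / 2) (divr2_gt0 e0).
have [t t0 ht] := hy (e / 2) (divr2_gt0 e0).
exists t => //; apply: le_trans (nm_triangle y _ _) _.
rewrite nmC in xy; lra.
Qed.

Lemma pos_eps x : (forall e, 0 < e -> pos (x + e%:A')) -> pos x.
Proof.
move=> h; apply: pos_adh => e e0; exists (x + e%:A'); first exact: h.
by rewrite opprD addrA subrr sub0r nmN nm_scr gtr0_norm.
Qed.

Lemma pos_nmB x : star x = x -> pos ((nm x)%:A' - x).
Proof.
move=> sx; split=> [|e e0]; first by rewrite starB star_scr sx.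
exists (nm x); first exact: nm_ge0.
by rewrite opprB addrC subrK; lra.
Qed.

Lemma pos_nmD x : star x = x -> pos ((nm x)%:A' + x).
Proof.
by move=> sx; have := @pos_nmB (- x); rewrite starN sx nmN opprK; apply.
Qed.

(** With nm (t - x) <= t + e/2 and T = t + e, one has x + e = T (1 - z) for z = (t - x) / T of norm
    < 1. The summand e makes this inequality strict, as [sqrt1B] requires. *)
Lemma pos_sqrt x e : pos x -> 0 < e ->
  exists y, [/\ star y = y, bicomm x y, pos y & y * y = x + e%:A'].
Proof.
move=> [sx hx] e0; have [t t0 ht] := hx (e / 2) (divr2_gt0 e0).
pose T := t + e; have T0 : 0 < T by rewrite /T; lra.
pose z := (T^-1)%:C *: (t%:A' - x).
have sz : star z = z by rewrite /z starZr starB star_scr sx.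
have nz : nm z < 1.
  rewrite /z nmZr gtr0_norm ?invr_gt0// mulrC ltr_pdivrMr// mul1r /T; lra.
have [y [sy cy ny hy]] := sqrt1B sz nz.
have sT : Num.sqrt T * Num.sqrt T = T by rewrite -expr2 sqr_sqrtr// ltW.
exists ((Num.sqrt T)%:C *: (1 - y)); split.
- by rewrite starZr starB star1 sy.
- move=> b bx; rewrite -scalerAl -scalerAr mulrBr mulrBl mulr1 mul1r; congr (_ *: (_ - _)).
  by apply: cy; rewrite /z -scalerAl -scalerAr mulrBl mulrBr bx scr_mull scr_mulr.
- split=> [|e' e'0]; first by rewrite starZr starB star1 sy.
  exists (Num.sqrt T); first exact: sqrtr_ge0.
  rewrite -scalerBr opprB addrC subrK nmZr ger0_norm ?sqrtr_ge0//.
  have := sqrtr_ge0 T; have : nm y <= 1 by lra.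
  nra.
- rewrite -scalerAl -scalerAr scalerr sT hy scalerBr /z scalerr divff ?gt_eqF// scale1r.
  by rewrite /T scrD; ncring.
Qed.

(** Once y is scaled to z with nm z < 1, 1 - z^2 is a square (1 - w)^2 and (1 - w)^2 + z^2 = 1.
    Hence nm (1 - z^2) <= 1, which is the norm criterion for y^2 at t = s^2. *)
Lemma pos_sqr y : star y = y -> pos (y * y).
Proof.
move=> sy; split=> [|e e0]; first by rewrite starMr sy.
pose s := nm y + 1; have s0 : 0 < s by rewrite /s; have := nm_ge0 y; lra.
pose z := (s^-1)%:C *: y.
have sz : star z = z by rewrite /z starZr sy.
have nz : nm z < 1.
  by rewrite /z nmZr gtr0_norm ?invr_gt0// mulrC ltr_pdivrMr// mul1r /s; lra.
have szz : star (z * z) = z * z by rewrite starMr sz.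
have nzz : nm (z * z) < 1.
  by have := nmM z z; have := nm_ge0 z; nra.
have [w [sw cw _ hw]] := sqrt1B szz nzz.
have zw : z * w = w * z by apply: cw; rewrite mulrA.
have n1 : nm (1 - w) <= 1.
  apply: (@nm_le1_sum_sqr _ z) => //; first by rewrite starB star1 sw.
    by rewrite mulrBl mulrBr mul1r mulr1 zw.
  by rewrite hw subrK.
exists (s * s); first by rewrite mulr_ge0// ltW.
have -> : (s * s)%:A' - y * y = (s * s)%:C *: (1 - z * z).
  rewrite scalerBr /z -scalerAl -scalerAr !scalerr.
  have -> : s * s / s / s = 1 by field; rewrite gt_eqF.
  by rewrite scale1r.
rewrite nmZr ger0_norm ?mulr_ge0 ?(ltW s0)// -hw.
have n2 : nm ((1 - w) * (1 - w)) <= 1.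
  by have := nmM (1 - w) (1 - w); have := nm_ge0 (1 - w); nra.
have s2 : 0 < s * s by rewrite mulr_gt0.
by apply: (@le_trans _ _ (s * s)); [rewrite ler_piMr// ltW | lra].
Qed.

(** Take roots v of x + d and w of y + d. Bicommutants make v and w commute, so (x + d)(y + d) = (v
    w)^2 is positive; it tends to x y with d, and the cone is closed. *)
Lemma pos_mul x y : x * y = y * x -> pos x -> pos y -> pos (x * y).
Proof.
move=> xy px py; apply: pos_adh => e e0.
pose K := nm x + nm y + 1.
have K1 : 1 <= K by rewrite /K; have := nm_ge0 x; have := nm_ge0 y; lra.
pose d := Num.min 1 (e / K).
have d0 : 0 < d by rewrite lt_min ltr01 divr_gt0//; lra.
have d1 : d <= 1 by rewrite ge_min lexx.
have dK : d * K <= e by rewrite -ler_pdivlMr ?ge_min ?lexx ?orbT//; lra.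
have [v [sv cv _ hv]] := pos_sqrt px d0; have [w [sw cw _ hw]] := pos_sqrt py d0.
have vw : v * w = w * v by apply: cw; rewrite (cv _ (esym xy)).
exists ((v * w) * (v * w)); first by apply: pos_sqr; rewrite starMr sv sw vw.
have -> : v * w * (v * w) = (v * v) * (w * w) by rewrite -!mulrA (mulrA w) -vw !mulrA.
rewrite hv hw.
have -> : x * y - (x + d%:A') * (y + d%:A') = - (x * d%:A' + d%:A' * y + d%:A' * d%:A')
  by ncring.
rewrite nmN !scr_mull scr_mulr scalerr.
apply: le_trans (nmD _ _) _.
apply: le_trans (lerD (nmD _ _) (lexx _)) _.
rewrite !nmZr nm1 !ger0_norm ?mulr_ge0 ?(ltW d0)//.
apply: le_trans dK; rewrite /K; have := nm_ge0 x; have := nm_ge0 y; nra.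
Qed.

(** With roots v of T - x and w of T + x, where T = s + e, the identity x^2 + (v w)^2 = T^2 gives nm
    x <= T through [nm_le1_sum_sqr]. *)
Lemma order_nm x s : star x = x -> 0 <= s -> pos (s%:A' - x) -> pos (s%:A' + x) ->
  nm x <= s.
Proof.
move=> sx s0 p1 p2; apply: le_eps => e e0.
have [v [sv cv _ hv]] := pos_sqrt p1 e0; have [w [sw cw _ hw]] := pos_sqrt p2 e0.
have xw : x * w = w * x by apply: cw; rewrite mulrDr mulrDl scr_mull scr_mulr.
have xv : x * v = v * x by apply: cv; rewrite mulrBr mulrBl scr_mull scr_mulr.
have vw : w * v = v * w.
  by apply: cv; rewrite mulrBr mulrBl scr_mull scr_mulr xw.
pose T := s + e; have T0 : 0 < T by rewrite /T; lra.
have Ti : `|T^-1| = T^-1 by rewrite gtr0_norm// invr_gt0.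
suff : nm ((T^-1)%:C *: x) <= 1 by rewrite nmZr Ti mulrC ler_pdivrMr// mul1r.
apply: (@nm_le1_sum_sqr _ ((T^-1)%:C *: (v * w))).
- by rewrite starZr sx.
- by rewrite starZr starMr sv sw vw.
- by rewrite -!scalerAl -!scalerAr mulrA xv -mulrA xw mulrA.
- rewrite -!scalerAl -!scalerAr !scalerr -scalerDr.
  have -> : v * w * (v * w) = (v * v) * (w * w) by rewrite -!mulrA (mulrA w) vw !mulrA.
  rewrite hv hw.
  have -> : s%:A' - x + e%:A' = T%:A' - x by rewrite /T scrD; ncring.
  have -> : s%:A' + x + e%:A' = T%:A' + x by rewrite /T scrD; ncring.
  have -> : x * x + (T%:A' - x) * (T%:A' + x) = T%:A' * T%:A' + (T%:A' * x - x * T%:A')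
    by ncring.
  rewrite !scr_mull scr_mulr subrr addr0 !scalerr.
  have -> : T^-1 / T * (T * T) = 1 by field; rewrite gt_eqF.
  by rewrite scale1r.
Qed.

Lemma pos_le_nm x s : 0 <= s -> pos x -> pos (s%:A' - x) -> nm x <= s.
Proof.
move=> s0 px h; apply: order_nm => //; first exact: pos_sa.
by apply: posD px; apply: pos_scr.
Qed.

End Positivity.

(** * Positivity of [star a * a] *)

Section KelleyVaught.
Variables (R : realType) (A : cstarAlgType R).
Implicit Types (a b c x y z u v : A) (t s e : R).

Local Notation "t %:A'" := (t%:C *: (1 : A)) (at level 2, format "t %:A'").

Lemma pos_addscr x t s : t <= s -> pos (x + t%:A') -> pos (x + s%:A').
Proof.
move=> ts px; have -> : x + s%:A' = x + t%:A' + (s - t)%:A' by rewrite scrB; ncring.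
by apply: posD px _; apply: pos_scr; rewrite subr_ge0.
Qed.

(** The inverse v = u v^2 is positive, and with c = nm v the element u - 1/c = (c - v) u / c is a
    product of commuting positive elements. *)
Lemma pos_unit_lower u v : pos u -> u * v = 1 -> exists2 e, 0 < e & pos (u + (- e)%:A').
Proof.
move=> pu uv; have su := pos_sa pu.
have svu : star v * u = 1 by rewrite -{1}su -starMr uv star1.
have sv : star v = v by rewrite -[LHS]mulr1 -uv mulrA svu mul1r.
have vu : v * u = 1 by rewrite -{1}sv.
have pv : pos v.
  have -> : v = u * (v * v) by rewrite mulrA uv mul1r.
  by apply: pos_mul pu _; [rewrite mulrA uv mul1r -mulrA vu mulr1 | apply: pos_sqr].
have n0 : 0 < nm v.
  rewrite lt_def nm_ge0 andbT; apply/eqP => /nm_eq0 v0.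
  by move: uv; rewrite v0 mulr0 => /esym/eqP; rewrite oner_eq0.
exists (nm v)^-1; first by rewrite invr_gt0.
have -> : u + (- (nm v)^-1)%:A' = (nm v)^-1%:C *: (((nm v)%:A' - v) * u).
  rewrite mulrBl vu scr_mull scalerBr scalerr mulVf ?gt_eqF// scale1r.
  by rewrite rmorphN scaleNr.
apply: posZ; first by rewrite invr_ge0 nm_ge0.
apply: pos_mul pu; last exact: pos_nmB.
by rewrite mulrBl mulrBr scr_mull scr_mulr uv vu.
Qed.

Lemma pos_lower_unit u e : 0 < e -> pos (u - e%:A') -> exists v, u * v = 1 /\ v * u = 1.
Proof.
move=> e0 [_ h]; have [t t0 ht] := h _ (divr2_gt0 e0).
pose T := t + e; have T0 : 0 < T by rewrite /T; lra.
have Tn0 : T != 0 by rewrite gt_eqF.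
have [|v [uv vu]] := @inv_near1 _ _ (T^-1%:C *: u).
  have -> : 1 - T^-1%:C *: u = T^-1%:C *: (t%:A' - (u - e%:A')).
    have -> : t%:A' - (u - e%:A') = T%:A' - u by rewrite /T scrD; ncring.
    by rewrite scalerBr scalerr mulVf// scale1r.
  rewrite nmZr gtr0_norm ?invr_gt0// mulrC ltr_pdivrMr// mul1r /T; lra.
exists (T^-1%:C *: v); move: uv vu.
by rewrite -!scalerAl -!scalerAr.
Qed.

(* The spectra of c^* c and c c^* agree away from 0. *)
Lemma pos_swap c s : 0 <= s -> pos (c * star c + s%:A') -> pos (star c * c + s%:A').
Proof.
move=> s0 hy; pose x := star c * c.
have sx : star x = x by rewrite /x starMr starK.
apply: pos_eps => e e0; rewrite -addrA -scrD; set t := s + e.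
have ts : s < t by rewrite /t; lra.
have [//|npt] := pselect (pos (x + t%:A')); exfalso.
(* As r decreases, positivity of x + r can only be lost where x + r is not invertible. At the
   infimum of [S] an inverse is available, so r can be decreased further: a contradiction. *)
pose S := [set r | t <= r /\ pos (x + r%:A')].
have hS : has_inf S.
  split; last by exists t => r [].
  exists (t + nm x); split; first by rewrite lerDl nm_ge0.
  rewrite scrD addrC -addrA; apply: posD; first by apply: pos_scr; lra.
  exact: pos_nmD.
have tS : t <= inf S by apply: lb_le_inf; [case: hS | move=> r []].
have pS : pos (x + (inf S)%:A').
  apply: pos_eps => d d0; have [r [tr pr] rd] := inf_adherent d0 hS.
  by rewrite -addrA -scrD; apply: pos_addscr pr; apply: ltW.
have [v xv] : exists v, (x + (inf S)%:A') * v = 1.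
  have l0 : 0 < inf S - s by lra.
  have [|w [yw _]] := @pos_lower_unit (c * star c + (inf S)%:A') _ l0.
    by rewrite scrB; have -> : forall y z w : A, y + z - (z - w) = y + w by move=> *; ncring.
  have ln : inf S != 0 by rewrite gt_eqF//; lra.
  (* The inverse of [star c * c + r] in terms of the inverse [w] of [c * star c + r], at r = inf
     S. *)
  exists ((inf S)^-1%:C *: (1 - star c * w * c)).
  rewrite -scalerAr.
  have -> : (x + (inf S)%:A') * (1 - star c * w * c) =
     x + (inf S)%:A' - star c * ((c * star c + (inf S)%:A') * w) * c.
    rewrite mulrBr mulr1; congr (_ - _).
    rewrite !mulrDl !mulrDr mulrDl !scr_mull /x -scalerAr -scalerAl !mulrA //.
  by rewrite yw mulr1 addrAC subrr add0r scalerr mulVf// scale1r.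
have [d d0 pd] := pos_unit_lower pS xv.
move: pd; rewrite -addrA -scrD => pd.
have [h|h] := leP t (inf S + - d).
  have : inf S <= inf S + - d by apply: ge_inf; [case: hS | split].
  by rewrite lerDl oppr_ge0 leNgt d0.
by apply: npt; apply: pos_addscr pd; apply: ltW.
Qed.

Lemma mulii : 'i * 'i = -1 :> R[i].
Proof.
by apply/eqP; rewrite eq_complex /= !(mul0r, mulr0, mulr1, mul1r, add0r, addr0, sub0r, oppr0) !eqxx.
Qed.

Lemma starZi x : star ('i *: x) = - ('i *: star x).
Proof.
by rewrite starZc -scaleNr; congr (_ *: _); apply/eqP; rewrite eq_complex /= oppr0 !eqxx.
Qed.

Definition re_part c := 2^-1%:C *: (c + star c).
Definition im_part c := 2^-1%:C *: ('i *: (star c - c)).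

Lemma re_part_sa c : star (re_part c) = re_part c.
Proof. by rewrite starZr starDr starK addrC. Qed.

Lemma im_part_sa c : star (im_part c) = im_part c.
Proof. by rewrite starZr starZi starB starK -scalerN opprB. Qed.

Lemma nm_re_part c : nm (re_part c) <= nm c.
Proof.
rewrite nmZr ger0_norm//; have := nmD c (star c); rewrite nm_star; lra.
Qed.

Lemma nm_im_part c : nm (im_part c) <= nm c.
Proof.
rewrite nmZr nmZ nmci mul1r ger0_norm//; have := nmB (star c) c; rewrite nm_star; lra.
Qed.

Lemma re_im_part c : re_part c + 'i *: im_part c = c.
Proof.
rewrite /re_part /im_part !scalerA mulrAC mulii mulN1r scaleNr -scalerN opprB -scalerDr.
rewrite (_ : c + star c + (c - star c) = c + c); last by ncring.
rewrite scalerDr -scalerDl -rmorphD /= (_ : 2^-1 + 2^-1 = 1) ?scale1r//; lra.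
Qed.

(** For c = x + i y with x and y self-adjoint the cross terms cancel and 2 x^2 + 2 y^2 is left. *)
Lemma pos_star_add c : pos (star c * c + c * star c).
Proof.
rewrite -(re_im_part c); have := im_part_sa c; have := re_part_sa c.
move: (re_part c) (im_part c) => x y sx sy.
have -> : star (x + 'i *: y) * (x + 'i *: y) + (x + 'i *: y) * star (x + 'i *: y) =
   x * x + x * x + (y * y + y * y).
  rewrite starDr starZi sx sy.
  have -> : forall z : A, (x - z) * (x + z) + (x + z) * (x - z) = x * x + x * x - (z * z + z * z)
    by move=> z; ncring.
  by rewrite -!scalerAl -!scalerAr !scalerA mulii !scaleN1r opprD opprK.
by do !apply: posD; apply: pos_sqr.
Qed.

(* With z = a^* a, r = (z^2 + e^2)^(1/2) and p = r - z one has
   (a p)^* (a p) = (e^2 p - p^3) / 2; as (a p)(a p)^* is bounded below by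
   -e^2 p / 2, exchanging the factors bounds p^3 by a multiple of e^2. *)
Lemma pos_star_mul a : pos (star a * a).
Proof.
set z := star a * a.
have sz : star z = z by rewrite /z starMr starK.
(* A bound of nm p uniform in e <= 1, since r^2 = z^2 + e^2 gives nm r <= nm z + 1. *)
pose K := 2 * nm z + 2.
have K2 : 2 <= K by rewrite /K; have := nm_ge0 z; lra.
have key e : 0 < e -> e <= 1 -> exists r, [/\ pos r, nm (r - z) <= K &
    nm (r - z) ^+ 4 <= 3 * K ^+ 2 * (e * e)].
  move=> e0 e1; have ee0 : 0 < e * e by rewrite mulr_gt0.
  have pzz := pos_sqr sz.
  have [r [sr cr pr rr]] := pos_sqrt pzz ee0.
  have rz : z * r = r * z by apply: cr; rewrite mulrA.
  exists r; pose p := r - z.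
  have sp : star p = p by rewrite /p starB sr sz.
  have [v [rrv vrr]] : exists v, r * r * v = 1 /\ v * (r * r) = 1.
    by apply: (@pos_lower_unit _ _ ee0); rewrite rr addrK.
  pose w := r * v.
  have rw : r * w = 1 by rewrite /w mulrA.
  have sv : star v = v.
    have svr : star v * (r * r) = 1 by rewrite -star1 -rrv !starMr sr.
    by rewrite -[LHS]mulr1 -rrv mulrA svr mul1r.
  have rv : r * v = v * r.
    by rewrite -[LHS]mul1r -vrr -!mulrA (mulrA r r v) rrv mulr1.
  have sw : star w = w by rewrite /w starMr sv sr -rv.
  have wr : w * r = 1 by rewrite -{1}sw -{1}sr -starMr rw star1.
  have pw : pos w.
    have -> : w = r * (w * w) by rewrite mulrA rw mul1r.
    by apply: pos_mul pr (pos_sqr sw); rewrite mulrA rw mul1r -mulrA wr mulr1.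
  have pp : p * p = r * r - z * r - z * r + z * z.
    have -> : p * p = r * r - r * z - z * r + z * z by rewrite /p; ncring.
    by rewrite -rz.
  (* From r^2 - z^2 = e^2. It exhibits p as (p^2 + e^2) r^-1 / 2, hence positive, and yields the
     formula for [star c * c] below. *)
  have prz : p * r + p * r = p * p + (e * e)%:A'.
    rewrite pp; have -> : (e * e)%:A' = r * r - z * z by rewrite rr addrAC subrr add0r.
    by rewrite /p; ncring.
  have wz : w * z = z * w.
    have -> : z * w = w * r * z * w by rewrite wr mul1r.
    by rewrite -(mulrA w r z) -rz -!mulrA rw mulr1.
  have wp : w * p = p * w by rewrite /p mulrBl mulrBr wr rw wz.
  have posp : pos p.
    have -> : p = 2^-1%:C *: ((p * p + (e * e)%:A') * w).
      rewrite -prz mulrDl -!mulrA rw mulr1.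
      have half2 : 2^-1 + 2^-1 = 1 :> R by lra.
      by rewrite scalerDr -scalerDl -rmorphD /= half2 scale1r.
    apply: posZ => //; apply: pos_mul pw; last by apply: posD (pos_sqr sp) (pos_scr _ (ltW ee0)).
    by rewrite [LHS]mulrDl [RHS]mulrDr scr_mull scr_mulr [w * (p * p)]mulrA wp -(mulrA p w p) wp mulrA.
  have zz_le : nm (z * z) <= nm z * nm z := nmM z z.
  have nr : nm r <= nm z + 1.
    have : nm r ^+ 2 <= (nm z + 1) ^+ 2.
      rewrite -nm_cstar sr rr; apply: le_trans (nmD _ _) _.
      rewrite nm_scr ger0_norm ?(ltW ee0)//; have := nm_ge0 z; nra.
    by rewrite ler_sqr ?nnegrE ?nm_ge0// addr_ge0 ?nm_ge0.
  have np : nm p <= K by rewrite /p /K; apply: le_trans (nmB _ _) _; have := nm_ge0 z; lra.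
  split=> //; rewrite -/p.
  pose c := a * p.
  have cc : star c * c + star c * c = (e * e)%:C *: p - p * p * p.
    rewrite /c starMr sp -!mulrA (mulrA (star a)) -/z.
    have zp : z * p = p * z by rewrite /p mulrBl mulrBr rz.
    have -> : p * (z * p) + p * (z * p) = p * (p * r + p * r) - (p * p * p + p * p * p).
      by rewrite zp /p; ncring.
    by rewrite prz mulrDr scr_mulr; ncring.
  pose h := (e * e * K) / 2.
  have h0 : 0 <= h by rewrite /h divr_ge0// mulr_ge0 ?(ltW ee0)//; lra.
  have posppp : pos (p * p * p).
    by apply: pos_mul => //; [rewrite mulrA | apply: pos_sqr].
  have half2 : 2^-1 + 2^-1 = 1 :> R by lra.
  have ccE : star c * c = 2^-1%:C *: ((e * e)%:C *: p - p * p * p).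
    by rewrite -cc scalerDr -scalerDl -rmorphD /= half2 scale1r.
  have low : pos (c * star c + h%:A').
    have -> : c * star c + h%:A' = (star c * c + c * star c) +
       2^-1%:C *: (p * p * p + (e * e)%:C *: ((K - nm p)%:A' + ((nm p)%:A' - p))).
      have -> : (K - nm p)%:A' + ((nm p)%:A' - p) = K%:A' - p by rewrite scrB; ncring.
      rewrite ccE !scalerBr scalerr scalerDr !scalerBr !scalerr -/h.
      rewrite (_ : 2^-1 * (e * e) * K = h); last by rewrite /h; field.
      ncring.
    apply: posD (pos_star_add c) _; apply: posZ => //; apply: posD posppp _.
    apply: posZ (ltW ee0) _; apply: posD; last exact: pos_nmB.
    by apply: pos_scr; rewrite subr_ge0.
  have up := pos_swap h0 low.
  (* As 2 h = e^2 K and p <= K, positivity of [star c * c + h] doubled reads p^3 <= 2 e^2 K. *)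
  have n3 : nm (p * p * p) <= e * e * K + e * e * K.
    apply: pos_le_nm => //; first by rewrite addr_ge0// !mulr_ge0 ?(ltW e0)//; lra.
    have -> : (e * e * K + e * e * K)%:A' - p * p * p =
      (star c * c + h%:A') + (star c * c + h%:A') + (e * e)%:C *:
        ((K - nm p)%:A' + ((nm p)%:A' - p)).
      have -> : (K - nm p)%:A' + ((nm p)%:A' - p) = K%:A' - p by rewrite scrB; ncring.
      rewrite addrACA cc -scrD (_ : h + h = e * e * K); last by rewrite /h; field.
      rewrite (scalerBr _ (K%:A')) scalerr scrD; ncring.
    apply: posD; first exact: posD.
    apply: posZ (ltW ee0) _; apply: posD; last exact: pos_nmB.
    by apply: pos_scr; rewrite subr_ge0.
  have n4 : nm p ^+ 4 <= nm (p * p * p) * nm p.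
    have -> : nm p ^+ 4 = nm (star (p * p) * (p * p)).
      by rewrite nm_cstar (_ : p * p = star p * p) ?nm_cstar -?exprM// sp.
    by rewrite starMr sp mulrA nmM.
  apply: le_trans n4 _; apply: le_trans (ler_pM (nm_ge0 _) (nm_ge0 _) n3 np) _.
  have : 0 <= e * e * K ^+ 2 by rewrite mulr_ge0 ?(ltW ee0)// sqr_ge0.
  by rewrite expr2; lra.
apply: pos_adh => d d0.
have K0 : 0 < 3 * K ^+ 2 by rewrite mulr_gt0// exprn_gt0//; lra.
(* Chosen so that 3 K^2 e^2 <= 3 K^2 e <= d^4: the positive element [r] is then within d of z. *)
pose e := Num.min 1 (d ^+ 4 / (3 * K ^+ 2)).
have e0 : 0 < e by rewrite lt_min ltr01 divr_gt0// exprn_gt0.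
have e1 : e <= 1 by rewrite ge_min lexx.
have eK : e * (3 * K ^+ 2) <= d ^+ 4 by rewrite -ler_pdivlMr// ge_min lexx orbT.
have [r [pr _ h]] := key _ e0 e1.
exists r => //; rewrite nmC.
rewrite -(@ler_pXn2r _ 4) ?nnegrE ?nm_ge0 ?(ltW d0)//.
apply: le_trans h _; apply: le_trans eK.
by rewrite [leRHS]mulrC; apply: ler_wpM2l; [exact: ltW | rewrite ler_piMl// ltW].
Qed.

End KelleyVaught.

(** * Sublinear functionals and a Hahn-Banach theorem *)

Section Sublinear.
Variables (R : realType) (V : lmodType R[i]).
Implicit Types (p q f : V -> R) (x y z : V) (t s : R).

Record sublinear q : Prop := Sublinear {
  sublinearD : forall x y, q (x + y) <= q x + q y ;
  sublinearZ : forall t x, 0 <= t -> q (t%:C *: x) <= t * q x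
}.

Lemma sublinear0 q : sublinear q -> q 0 = 0.
Proof.
move=> [qD qZ]; have := qD 0 0; have := qZ 0 0 (lexx _).
by rewrite scaler0 mul0r addr0 => h1 h2; apply/eqP; rewrite eq_le h1/=; lra.
Qed.

Lemma sublinearN q x : sublinear q -> - q (- x) <= q x.
Proof.
move=> sq; have := sublinearD sq x (- x); rewrite subrr sublinear0//; lra.
Qed.

Lemma sublinearZ_ge q t x : sublinear q -> 0 <= t -> t * q x <= q (t%:C *: x).
Proof.
move=> sq; rewrite le_eqVlt => /orP[/eqP<-|t0].
  by rewrite scale0r mul0r sublinear0.
have ti : 0 <= t^-1 by rewrite invr_ge0 ltW.
have := sublinearZ sq (t%:C *: x) ti.
by rewrite scalerA -rmorphM /= mulVf ?gt_eqF// scale1r ler_pdivlMl.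
Qed.

(** The lower bound - q (- x) keeps the infimum finite. Subadditivity uses that F is a chain: given
    f at x and g at y, the smaller of the two functionals serves at both points. *)
Lemma sublinear_inf (q : V -> R) (F : set (V -> R)) : F !=set0 ->
  (forall f, F f -> sublinear f /\ forall x, f x <= q x) ->
  (forall f g, F f -> F g -> (forall x, f x <= g x) \/ (forall x, g x <= f x)) ->
  let p x := inf [set f x | f in F] in
  sublinear p /\ forall f x, F f -> p x <= f x.
Proof.
move=> [f0 Ff0] hF tot p.
have lb x : has_lbound [set f x | f in F].
  exists (- q (- x)) => _ [f Ff <-]; have [sf fq] := hF _ Ff.
  by apply: le_trans (sublinearN _ sf); rewrite lerN2.
have pf f x : F f -> p x <= f x by move=> Ff; apply: ge_inf => //; exists f.
have lep x t : (forall f, F f -> t <= f x) -> t <= p x.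
  by move=> h; apply: lb_le_inf => [|_ [f Ff <-]]; [exists (f0 x), f0 | apply: h].
split => //; split=> [x y|t x t0].
- rewrite -lerBlDl; apply: (lep) => g Fg; rewrite lerBlDr -lerBlDl.
  apply: (lep) => f Ff; rewrite lerBlDl.
  have [sf _] := hF _ Ff; have [sg _] := hF _ Fg.
  have [h|h] := tot _ _ Ff Fg.
    apply: le_trans (pf _ _ Ff) _; apply: le_trans (sublinearD sf _ _) _.
    by rewrite [leRHS]addrC lerD2l.
  apply: le_trans (pf _ _ Fg) _; apply: le_trans (sublinearD sg _ _) _.
  by rewrite [leRHS]addrC lerD2r.
- move: t0; rewrite le_eqVlt => /orP[/eqP<-|t0].
    by rewrite mul0r scale0r; apply: le_trans (pf _ _ Ff0) _; rewrite sublinear0//; apply: (hF _ Ff0).1.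
  rewrite -ler_pdivrMl//; apply: (lep) => f Ff; rewrite ler_pdivrMl//.
  by apply: le_trans (pf _ _ Ff) _; apply: sublinearZ (ltW t0); apply: (hF _ Ff).1.
Qed.

(** For sublinear p, this is the greatest sublinear functional below p whose value at - y is at most
    - p y. *)
Definition twist p y x := inf [set p (x + t%:C *: y) - t * p y | t in [set t | 0 <= t]].

Section Twist.
Variables (p : V -> R) (y : V).
Hypothesis sp : sublinear p.

Lemma twist_le x t : 0 <= t -> twist p y x <= p (x + t%:C *: y) - t * p y.
Proof.
move=> t0; apply: ge_inf; last by exists t.
exists (- p (- x)) => _ [s /= s0 <-].
have h1 := sublinearZ_ge y sp s0.
have := sublinearD sp (x + s%:C *: y) (- x); rewrite addrAC subrr add0r.
lra.
Qed.

Lemma le_twist x s : (forall t, 0 <= t -> s <= p (x + t%:C *: y) - t * p y) ->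
  s <= twist p y x.
Proof.
move=> h; apply: lb_le_inf => [|_ [t /= t0 <-]]; last exact: h.
by exists (p (x + 0%:C *: y) - 0 * p y), 0 => /=.
Qed.

Lemma twist_le_self x : twist p y x <= p x.
Proof. by have := twist_le x (lexx 0); rewrite scale0r addr0 mul0r subr0. Qed.

Lemma twist_sublinear : sublinear (twist p y).
Proof.
split=> [x z|t x].
- rewrite -lerBlDl; apply: le_twist => t t0; rewrite lerBlDr -lerBlDl.
  apply: le_twist => s s0; rewrite lerBlDl.
  apply: le_trans (twist_le _ (addr_ge0 s0 t0)) _.
  have := sublinearD sp (x + s%:C *: y) (z + t%:C *: y).
  by rewrite addrACA -scalerDl -rmorphD /=; lra.
- rewrite le_eqVlt => /orP[/eqP<-|t0].
    by rewrite mul0r scale0r; apply: le_trans (twist_le_self _) _; rewrite sublinear0.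
  rewrite -ler_pdivrMl//; apply: le_twist => s s0; rewrite ler_pdivrMl//.
  apply: le_trans (twist_le _ (mulr_ge0 (ltW t0) s0)) _.
  rewrite rmorphM -scalerA -scalerDr mulrBr mulrA lerD2r.
  by apply: sublinearZ => //; apply: ltW.
Qed.

End Twist.

(* A minimal sublinear functional is linear, since it is not lowered by any
   of its twists. *)
Lemma sublinear_hahn_banach q y : sublinear q -> exists f : V -> R,
  [/\ forall x z, f (x + z) = f x + f z, forall t x, f (t%:C *: x) = t * f x,
      forall x, f x <= q x & f y = q y].
Proof.
(* Staying below the twist of q by y forces f (- y) <= - q y, so that a linear f attains q at y. *)
move=> sq; pose q' := twist q y.
pose T := {f : V -> R | sublinear f /\ forall x, f x <= q' x}.
pose mk f (sf : sublinear f) (fq : forall x, f x <= q' x) : T := exist _ f (conj sf fq).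
(* The order is reversed: a maximal element for [Zorn] is a minimal functional. *)
pose below (f g : T) := `[< forall x, sval g x <= sval f x >].
have [||||[f [sf fq]] hmax] := @Zorn T below.
- by move=> f; apply/asboolP.
- move=> f g h /asboolP fg /asboolP gh; apply/asboolP => x.
  exact: le_trans (gh x) (fg x).
- move=> [f pf] [g pg] /asboolP /= fg /asboolP /= gf; apply: eq_exist.
  by apply/funext => x; apply/eqP; rewrite eq_le gf fg.
- move=> F tot; have [[f0 Ff0]|F0] := pselect (F !=set0); last first.
    exists (mk q' (twist_sublinear y sq) (fun x => lexx _)) => s Fs.
    by exfalso; apply: F0; exists s.
  pose G := [set sval f | f in F].
  have [|||sp pf] := @sublinear_inf q' G.
  + by exists (sval f0), f0.
  + by move=> _ [f Ff <-]; apply: (svalP f).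
  + move=> _ _ [f Ff <-] [g Fg <-].
    by have [/asboolP|/asboolP] := tot _ _ Ff Fg; [right|left].
  have pq x : inf [set f x | f in G] <= q' x.
    by apply: le_trans (pf (sval f0) x _) ((svalP f0).2 x); exists f0.
  exists (mk _ sp pq) => s Fs; apply/asboolP => x /=.
  by apply: pf; exists s.
have fmin z x : f x <= f (x + z) - f z.
  have tf : twist f z = f.
    pose g := mk (twist f z) (twist_sublinear z sf)
      (fun x => le_trans (twist_le_self z sf x) (fq x)).
    have /(congr1 sval) : g = mk f sf fq.
      by apply: hmax; apply/asboolP => w /=; apply: twist_le_self.
    by [].
  by rewrite -{1}tf; have := twist_le z sf x ler01; rewrite scale1r mul1r.
have fD x z : f (x + z) = f x + f z.
  apply/eqP; rewrite eq_le sublinearD//=; have := fmin z x; lra.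
have fN x : f (- x) = - f x.
  by have := fD x (- x); rewrite subrr sublinear0//; lra.
have fZ t x : f (t%:C *: x) = t * f x.
  have pZ s z : 0 <= s -> f (s%:C *: z) = s * f z.
    by move=> s0; apply/eqP; rewrite eq_le sublinearZ//= sublinearZ_ge.
  have [t0|t0] := leP 0 t; first exact: pZ.
  have := pZ (- t) x; rewrite oppr_ge0 (ltW t0) rmorphN scaleNr fN => /(_ isT).
  lra.
exists f; split => // [x|].
  exact: le_trans (fq x) (twist_le_self _ sq _).
apply/eqP; rewrite eq_le; apply/andP; split.
  exact: le_trans (fq y) (twist_le_self _ sq _).
have := le_trans (fq (- y)) (twist_le y sq (- y) ler01).
by rewrite scale1r mul1r addNr sublinear0// fN; lra.
Qed.

End Sublinear.

(** * States: existence, continuity, norming of self-adjoint elements *)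

Section States.
Variables (R : realType) (A : cstarAlgType R).
Implicit Types (a b c x y z : A) (t s e : R) (w : A -> R[i]).

Local Notation "t %:A'" := (t%:C *: (1 : A)) (at level 2, format "t %:A'").

(* The largest real part of w x over the states w. *)
Definition numrange_sup x := inf [set nm (t%:A' + x) - t | t in [set t | 0 <= t]].
Local Notation nq := numrange_sup.

Lemma numrange_sup_le x t : 0 <= t -> nq x <= nm (t%:A' + x) - t.
Proof.
move=> t0; apply: ge_inf; last by exists t.
exists (- nm x) => _ [s /= s0 <-].
have := nmB (s%:A' + x) x; rewrite addrK nm_scr ger0_norm//; lra.
Qed.

Lemma le_numrange_sup x s : (forall t, 0 <= t -> s <= nm (t%:A' + x) - t) -> s <= nq x.
Proof.
move=> h; apply: lb_le_inf => [|_ [t /= t0 <-]]; last exact: h.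
by exists (nm (0%:A' + x) - 0), 0 => /=.
Qed.

Lemma numrange_sup_adherent x e : 0 < e -> exists2 t, 0 <= t & nm (t%:A' + x) <= t + (nq x + e).
Proof.
move=> e0; have [t t0 h] : exists2 t, 0 <= t & nm (t%:A' + x) - t < nq x + e.
  have [|_ [t t0 <-] h] := @inf_adherent _ [set nm (t%:A' + x) - t | t in [set t | 0 <= t]] _ e0.
    split; first by exists (nm (0%:A' + x) - 0), 0 => /=.
    exists (- nm x) => _ [s /= s0 <-].
    have := nmB (s%:A' + x) x; rewrite addrK nm_scr ger0_norm//; lra.
  by exists t.
by exists t => //; lra.
Qed.

Lemma numrange_sublinear : sublinear nq.
Proof.
split=> [x z|t x].
- rewrite -lerBlDl; apply: le_numrange_sup => t t0; rewrite lerBlDr -lerBlDl.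
  apply: le_numrange_sup => s s0; rewrite lerBlDl.
  apply: le_trans (numrange_sup_le _ (addr_ge0 s0 t0)) _.
  have := nmD (s%:A' + x) (t%:A' + z).
  by rewrite addrACA -scrD; lra.
- rewrite le_eqVlt => /orP[/eqP<-|t0].
    by have := numrange_sup_le (0%:C *: x) (lexx 0); rewrite !scale0r addr0 nm0 mul0r subr0.
  rewrite -ler_pdivrMl//; apply: le_numrange_sup => s s0; rewrite ler_pdivrMl//.
  apply: le_trans (numrange_sup_le _ (mulr_ge0 (ltW t0) s0)) _.
  by rewrite -scalerr -scalerDr nmZr gtr0_norm// mulrBr.
Qed.

Lemma numrange_sup_pos x : pos x -> nq (- x) <= 0.
Proof.
move=> [_ hx]; apply: le_eps => e /hx[t t0 ht].
by apply: le_trans (numrange_sup_le _ t0) _; lra.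
Qed.

(** With n = nm x one has nm (t + i x)^2 = nm (t^2 + x^2) <= t^2 + n^2, so the excess over t is
    about n^2 / 2t; the choice t = n^2 / 2e makes it at most e. This is what makes a dominated
    functional real on self-adjoint elements. *)
Lemma numrange_sup_i x : star x = x -> nq ('i *: x) <= 0.
Proof.
move=> sx; apply: le_eps => e e0; rewrite add0r.
pose n := nm x; pose t := n ^+ 2 / (2 * e).
have t0 : 0 <= t by rewrite divr_ge0 ?sqr_ge0// mulr_ge0// ltW.
apply: le_trans (numrange_sup_le _ t0) _; rewrite lerBlDr.
have e2 : 0 <= e + t by rewrite addr_ge0// ltW.
rewrite -(@ler_pXn2r _ 2) ?nnegrE ?nm_ge0// -nm_cstar starDr star_scr starZi sx.
have -> : (t%:A' - 'i *: x) * (t%:A' + 'i *: x) = (t * t)%:A' + x * x.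
  have -> : forall y z : A, (y - z) * (y + z) = y * y + (y * z - z * y) - z * z
    by move=> *; ncring.
  rewrite !scr_mull scr_mulr subrr addr0 scalerr; congr (_ + _).
  by rewrite -scalerAl -scalerAr scalerA mulii scaleN1r opprK.
apply: le_trans (nmD _ _) _; rewrite nm_scr (ger0_norm (mulr_ge0 t0 t0)).
have h : 2 * e * t = n ^+ 2 by rewrite /t mulrC divfK// gt_eqF// mulr_gt0.
have := nmM x x; rewrite -/n; move: h; rewrite !expr2; have := sqr_ge0 e; rewrite expr2.
nra.
Qed.

(** A bound nq y <= s makes s - y positive; the two signs together are the hypotheses of
    [order_nm]. *)
Lemma order_numrange x s : star x = x -> nq x <= s -> nq (- x) <= s -> nm x <= s.
Proof.
move=> sx h1 h2.
have s0 : 0 <= s.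
  have := sublinearD numrange_sublinear x (- x).
  by rewrite subrr (sublinear0 numrange_sublinear); lra.
have hp y : star y = y -> nq y <= s -> pos (s%:A' - y).
  move=> sy h; split=> [|e e0]; first by rewrite starB star_scr sy.
  have [t t0 ht] := numrange_sup_adherent y e0.
  exists (t + s); first exact: addr_ge0.
  have -> : (t + s)%:A' - (s%:A' - y) = t%:A' + y by rewrite scrD; ncring.
  lra.
apply: order_nm => //; first exact: hp.
by rewrite -[x]opprK; apply: hp => //; rewrite starN sx.
Qed.

(** A real functional f below nq with f y = nq y is complexified to x -> f x - i f (i x). Domination
    does the rest: nq (i x) <= 0 makes it real on self-adjoint x, nq (- x) <= 0 on the cone makes it
    positive, and nq 1 <= 1 with nq (- 1) <= - 1 makes it unital. *)
Lemma numrange_state y : star y = y -> exists2 w, is_state w & nm (w y) >= nq y.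
Proof.
move=> sy; have [f [fD fZ fq fy]] := sublinear_hahn_banach y numrange_sublinear.
have fN x : f (- x) = - f x.
  by have := fZ (-1) x; rewrite rmorphN1 scaleN1r mulN1r.
have fi x : star x = x -> f ('i *: x) = 0.
  move=> sx; apply/eqP; rewrite eq_le; apply/andP; split.
    exact: le_trans (fq _) (numrange_sup_i sx).
  rewrite -oppr_le0 -fN -scalerN; apply: le_trans (fq _) _.
  by apply: numrange_sup_i; rewrite starN sx.
exists (fun x => f x +i* - f ('i *: x)).
  split.
  - move=> k a b; have fk c : f (k *: c) = complex.Re k * f c + complex.Im k * f ('i *: c).
      have -> : k *: c = (complex.Re k)%:C *: c + (complex.Im k)%:C *: ('i *: c).
        rewrite scalerA -scalerDl [in LHS](complexE k); congr ((_ + _) *: _).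
        by rewrite mulrC.
      by rewrite fD !fZ.
    have e1 : f (k *: a + b) = complex.Re k * f a + complex.Im k * f ('i *: a) + f b.
      by rewrite fD fk.
    have e2 : f ('i *: (k *: a + b)) =
        complex.Re k * f ('i *: a) - complex.Im k * f a + f ('i *: b).
      rewrite scalerDr fD scalerA mulrC -scalerA fk scalerA mulii scaleN1r fN.
      by rewrite mulrN.
    change (f (k *: a + b) +i* - f ('i *: (k *: a + b)) =
      k * (f a +i* - f ('i *: a)) + (f b +i* - f ('i *: b))).
    rewrite e1 e2; case: k {fk e1 e2} => k1 k2 /=.
    by apply/eqP; rewrite eq_complex /=; apply/andP; split; apply/eqP; ring.
  - move=> a; have pa := pos_star_mul a.
    rewrite /= (fi _ (pos_sa pa)) oppr0 ler0c -oppr_le0 -fN.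
    exact: le_trans (fq _) (numrange_sup_pos pa).
  - rewrite /= (fi _ (star1 A)) oppr0.
    have -> : f 1 = 1; last by [].
    apply/eqP; rewrite eq_le; apply/andP; split.
      apply: le_trans (fq _) _; apply: le_trans (numrange_sup_le _ (lexx 0)) _.
      by rewrite scale0r add0r subr0 nm1.
    rewrite -lerN2 -fN; apply: le_trans (fq _) _.
    by apply: le_trans (numrange_sup_le _ ler01) _; rewrite scale1r subrr nm0 sub0r.
rewrite -fy /= (fi _ sy) oppr0 nmcR; exact: ler_norm.
Qed.

Section StateLinear.
Variables (w : A -> R[i]) (sw : is_state w).

Lemma state0 : w 0 = 0.
Proof. by have := state_linear sw (-1) 0 0; rewrite scaler0 addr0 mulN1r addNr. Qed.

Lemma stateDr a b : w (a + b) = w a + w b.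
Proof. by have := state_linear sw 1 a b; rewrite scale1r mul1r. Qed.

Lemma stateZ (k : R[i]) a : w (k *: a) = k * w a.
Proof. by have := state_linear sw k a 0; rewrite !addr0 state0 addr0. Qed.

Lemma stateN a : w (- a) = - w a.
Proof. by rewrite -scaleN1r stateZ mulN1r. Qed.

Lemma stateB a b : w (a - b) = w a - w b.
Proof. by rewrite stateDr stateN. Qed.

Lemma state_scr t : w t%:A' = t%:C.
Proof. by rewrite stateZ (state1 sw) mulr1. Qed.

(** For every e > 0 the element x + e is the square of a self-adjoint root. *)
Lemma state_pos x : pos x -> 0 <= w x.
Proof.
move=> px; have h e : 0 < e -> 0 <= w x + e%:C.
  move=> e0; have [y [sy _ _ hy]] := pos_sqrt px e0.
  by have := state_ge0 sw y; rewrite sy hy stateDr state_scr.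
case: (w x) h => r i h.
have := h 1 ltr01; rewrite !lecE /= addr0 => /andP[/eqP -> _].
rewrite eqxx /= -oppr_le0; apply: le_eps => e /h.
by rewrite lecE /= => /andP[_]; lra.
Qed.

Lemma state_sa x : star x = x -> exists2 r : R, w x = r%:C & `|r| <= nm x.
Proof.
move=> sx; have := state_pos (pos_nmB sx); have := state_pos (pos_nmD sx).
rewrite stateB stateDr state_scr !lecE /=; case: (w x) => r i /= /andP[/eqP h1 h2] /andP[_ h3].
rewrite add0r in h1; exists r; first by rewrite h1.
by rewrite ler_norml; apply/andP; split; lra.
Qed.

Lemma state_star a : w (star a) = conjc (w a).
Proof.
rewrite -(re_im_part a) starDr starZi re_part_sa im_part_sa stateB stateDr !(stateZ 'i).
have [r -> _] := state_sa (re_part_sa a); have [s -> _] := state_sa (im_part_sa a).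
by apply/eqP; rewrite eq_complex /=; apply/andP; split; apply/eqP; ring.
Qed.

(** Real and imaginary parts are bounded separately, whence 2 in place of the optimal 1. What
    matters is a bound independent of the state; the constants 4, 3 and 6 further down come from
    it. *)
Lemma nm_state a : nm (w a) <= 2 * nm a.
Proof.
rewrite -[in leLHS](re_im_part a) stateDr (stateZ 'i); apply: le_trans (nmD _ _) _.
rewrite nmcM nmci mul1r.
have [r -> hr] := state_sa (re_part_sa a); have [s -> hs] := state_sa (im_part_sa a).
rewrite !nmcR; have := nm_re_part a; have := nm_im_part a; lra.
Qed.

End StateLinear.

Lemma state_norming x : star x = x -> exists2 w, is_state w & nm x <= nm (w x).
Proof.
move=> sx; have sNx : star (- x) = - x by rewrite starN sx.
have [w1 st1 h1] := numrange_state sx; have [w2 st2 h2] := numrange_state sNx.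
have w2N : nm (w2 (- x)) = nm (w2 x) by rewrite stateN// nmN.
have [h|h] := leP (nq x) (nq (- x)).
  exists w2 => //; rewrite -w2N; apply: le_trans h2.
  exact: order_numrange.
exists w1 => //; apply: le_trans h1.
by apply: order_numrange => //; apply: ltW.
Qed.

End States.

(** * Unital star homomorphisms are contractive *)

Section StarHom.
Variables (R : realType) (A B : cstarAlgType R) (f : A -> B).
Hypothesis hf : star_hom f.
Implicit Types (a b h m : A).

Lemma star_hom0 : f 0 = 0.
Proof. by have := star_hom_linear hf (-1) 0 0; rewrite scaler0 addr0 scaleN1r addNr. Qed.

Lemma star_homD a b : f (a + b) = f a + f b.
Proof. by have := star_hom_linear hf 1 a b; rewrite !scale1r. Qed.

Lemma star_homZ (k : R[i]) a : f (k *: a) = k *: f a.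
Proof. by have := star_hom_linear hf k a 0; rewrite !addr0 star_hom0 addr0. Qed.

Lemma star_homN a : f (- a) = - f a.
Proof. by rewrite -scaleN1r star_homZ scaleN1r. Qed.

Lemma star_homB a b : f (a - b) = f a - f b.
Proof. by rewrite star_homD star_homN. Qed.

Lemma star_homM a b : f (a * b) = f a * f b.
Proof. exact: star_hom_mul hf a b. Qed.

Lemma star_homS a : f (star a) = star (f a).
Proof. exact: star_hom_star hf a. Qed.

Lemma star_hom_alg (k : R[i]) : f k%:A = k%:A.
Proof. by rewrite star_homZ (star_hom_one hf). Qed.

End StarHom.

(** Here m is a root of 1 - h^2, as sine is to cosine. The conclusions are algebraic, so a unital
    map respecting sums, products and adjoints carries them along, and [nm_le1_sum_sqr] turns them
    back into a norm bound at the target. *)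
Lemma sa_complement (R : realType) (A : cstarAlgType R) (h : A) :
  star h = h -> nm h < 1 ->
  exists m, [/\ star m = m, h * m = m * h & h * h + m * m = 1].
Proof.
move=> sh nh; have shh : star (h * h) = h * h by rewrite starMr sh.
have nhh : nm (h * h) < 1 by have := nmM h h; have := nm_ge0 h; nra.
have [y [sy cy _ hy]] := sqrt1B shh nhh.
exists (1 - y); split; first by rewrite starB star1 sy.
  by rewrite mulrBl mulrBr mul1r mulr1 cy// mulrA.
by rewrite hy addrC subrK.
Qed.

Lemma nm_star_hom (R : realType) (A B : cstarAlgType R) (f : A -> B) a :
  star_hom f -> nm (f a) <= nm a.
Proof.
move=> hf.
have hsa h : star h = h -> nm (f h) <= nm h.
  move=> sh; apply: le_eps => e e0; pose t := nm h + e.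
  have t0 : 0 < t by rewrite /t; have := nm_ge0 h; lra.
  have st : star (t^-1%:C *: h) = t^-1%:C *: h by rewrite starZr sh.
  have nt : nm (t^-1%:C *: h) < 1.
    by rewrite nmZr gtr0_norm ?invr_gt0// mulrC ltr_pdivrMr// mul1r /t; lra.
  have [m [sm hm h1]] := sa_complement st nt.
  have : nm (f (t^-1%:C *: h)) <= 1.
    apply: (@nm_le1_sum_sqr _ _ _ (f m)).
    - by rewrite -(star_homS hf) st.
    - by rewrite -(star_homS hf) sm.
    - by rewrite -!(star_homM hf) hm.
    - by rewrite -!(star_homM hf) -(star_homD hf) h1 (star_hom_one hf).
  by rewrite (star_homZ hf) nmZr gtr0_norm ?invr_gt0// mulrC ler_pdivrMr// mul1r.
rewrite -ler_sqr ?nnegrE ?nm_ge0// -!nm_cstar -(star_homS hf) -(star_homM hf).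
by apply: hsa; rewrite starMr starK.
Qed.

Lemma star_hom_lip (R : realType) (A B : cstarAlgType R) (f : A -> B) a b :
  star_hom f -> nm (f a - f b) <= 1 * nm (a - b).
Proof. by move=> hf; rewrite mul1r -(star_homB hf) nm_star_hom. Qed.

(** * Cuntz families and block-diagonal sums *)

Section CuntzFamily.
Variables (R : realType) (n : nat) (E : cstarAlgType R) (S : 'I_n -> E).
Hypothesis cS : cuntz_family S.
Implicit Types (x y : 'I_n -> E).

(** The positive elements [X k] sum to [star (S j) * S j = 1] and [X j] is already 1, so the others
    vanish; and [X i] has norm nm (star (S i) * S j)^2. *)
Lemma cuntz_orthogonal i j : star (S i) * S j = (i == j)%:R.
Proof.
have [<-|ij] := eqVneq i j; first by rewrite (cuntz_isometry cS).
pose X k := star (S j) * S k * (star (S k) * S j).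
have pX k : pos (X k).
  have -> : X k = star (star (S k) * S j) * (star (S k) * S j).
    by rewrite starMr starK.
  exact: pos_star_mul.
have sX : \sum_k X k = 1.
  rewrite -(cuntz_isometry cS j) -[in RHS](mulr1 (star (S j))) -(cuntz_sum cS).
  by rewrite mulr_sumr mulr_suml; apply: eq_bigr => k _; rewrite /X !mulrA.
have s0 : X i + \sum_(k | (k != j) && (k != i)) X k = 0.
  move: sX; rewrite (bigD1 j)//= (bigD1 i)//= {1}/X (cuntz_isometry cS) mulr1.
  by move=> /(congr1 (fun z => z - 1)); rewrite subrr addrAC subrr add0r.
have p2 : pos (\sum_(k | (k != j) && (k != i)) X k).
  rewrite big_mkcond; apply: pos_sum => k; case: ifP => // _.
  by rewrite -(scale0r 1); apply: pos_scr.
have : nm (X i) <= 0.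
  apply: pos_le_nm => //; rewrite scale0r sub0r.
  by have -> : - X i = \sum_(k | (k != j) && (k != i)) X k
    by apply/eqP; rewrite eq_sym -addr_eq0 addrC s0.
have -> : X i = star (star (S i) * S j) * (star (S i) * S j) by rewrite starMr starK.
rewrite nm_cstar => h; apply: nm_eq0; apply/eqP.
by rewrite -sqrf_eq0 eq_le h sqr_ge0.
Qed.

(** The block-diagonal embedding of E^n into E, a unital star homomorphism; by [nm_sum_conj] it is
    contractive for the maximum norm, so no factor n enters the estimates. *)
Definition cuntz_sum_conj x := \sum_i S i * x i * star (S i).
Local Notation theta := cuntz_sum_conj.

Lemma sum_conjM x y : theta x * theta y = theta (fun i => x i * y i).
Proof.
rewrite /theta mulr_suml; apply: eq_bigr => i _.
rewrite mulr_sumr (bigD1 i)//= big1 ?addr0 => [|j ji].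
  rewrite -!mulrA (mulrA (star (S i))) cuntz_orthogonal eqxx mul1r.
  by rewrite !mulrA.
rewrite -!mulrA (mulrA (star (S i))) cuntz_orthogonal eq_sym (negbTE ji).
by rewrite mul0r !mulr0.
Qed.

Lemma sum_conj_star x : star (theta x) = theta (fun i => star (x i)).
Proof.
by rewrite /theta star_sum; apply: eq_bigr => i _; rewrite !starMr starK mulrA.
Qed.

Lemma sum_conjD x y : theta x + theta y = theta (fun i => x i + y i).
Proof.
by rewrite /theta -big_split; apply: eq_bigr => i _ /=; rewrite mulrDr mulrDl.
Qed.

Lemma sum_conjZ (k : R[i]) x : k *: theta x = theta (fun i => k *: x i).
Proof.
by rewrite /theta scaler_sumr; apply: eq_bigr => i _ /=; rewrite -scalerAr -scalerAl.
Qed.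

Lemma sum_conjB x y : theta x - theta y = theta (fun i => x i - y i).
Proof.
rewrite -scaleN1r sum_conjZ sum_conjD; congr theta; apply/funext => i.
by rewrite scaleN1r.
Qed.

Lemma sum_conj1 : theta (fun=> 1) = 1.
Proof.
by rewrite -[RHS](cuntz_sum cS); apply: eq_bigr => i _; rewrite mulr1.
Qed.

Lemma sum_conj_mulS x i : theta x * S i = S i * x i.
Proof.
rewrite /theta mulr_suml (bigD1 i)//= big1 ?addr0 => [|j ji].
  by rewrite -!mulrA (cuntz_isometry cS) mulr1.
by rewrite -!mulrA cuntz_orthogonal (negbTE ji) !mulr0.
Qed.

Lemma nm_sum_conj x (t : R) : 0 <= t -> (forall i, nm (x i) <= t) -> nm (theta x) <= t.
Proof.
move=> t0 hx.
have hsa y (s : R) : 0 <= s -> (forall i, star (y i) = y i) -> (forall i, nm (y i) <= s) ->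
    nm (theta y) <= s.
  move=> s0 sy hy; apply: le_eps => e e0; pose T := s + e.
  have T0 : 0 < T by rewrite /T; lra.
  have : forall i, exists m, [/\ star m = m, T^-1%:C *: y i * m = m * (T^-1%:C *: y i)
      & T^-1%:C *: y i * (T^-1%:C *: y i) + m * m = 1].
    move=> i; apply: sa_complement; first by rewrite starZr sy.
    rewrite nmZr gtr0_norm ?invr_gt0// mulrC ltr_pdivrMr// mul1r.
    by apply: le_lt_trans (hy i) _; rewrite /T; lra.
  move=> /choice[m hm].
  have : nm (theta (fun i => T^-1%:C *: y i)) <= 1.
    apply: (@nm_le1_sum_sqr _ _ _ (theta m)).
    - by rewrite sum_conj_star; congr theta; apply/funext => i; rewrite starZr sy.
    - by rewrite sum_conj_star; congr theta; apply/funext => i; have [] := hm i.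
    - by rewrite !sum_conjM; congr theta; apply/funext => i; have [] := hm i.
    - by rewrite !sum_conjM sum_conjD -sum_conj1; congr theta; apply/funext => i; have [] := hm i.
  by rewrite -sum_conjZ nmZr gtr0_norm ?invr_gt0// mulrC ler_pdivrMr// mul1r.
rewrite -ler_sqr ?nnegrE ?nm_ge0// -nm_cstar sum_conj_star sum_conjM.
apply: hsa; first exact: sqr_ge0.
  by move=> i; rewrite starMr starK.
by move=> i; rewrite nm_cstar ler_sqr ?nnegrE ?nm_ge0.
Qed.

End CuntzFamily.

(** * Long words of endomorphisms send elements close to scalars *)

Section Contraction.
Variables (R : realType) (A B : cstarAlgType R).
Variables (la : A -> B -> B) (ra : B -> A -> B) (Dom : set A) (delta : A -> B).
Hypothesis hdelta : star_derivation la ra Dom delta.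
Hypothesis hbounded : exists M : R, forall a,
  lipschitz_ball Dom delta a -> quotient_norm a <= M.
Variables (n : nat) (phi : 'I_n -> A -> A).
Hypothesis hphi : forall i, star_hom (phi i).
Hypothesis hcontr : forall i, proper_contraction Dom delta (fun w => w \o phi i).
Implicit Types (w : A -> R[i]) (a b x : A) (m : seq 'I_n) (e : R).

Lemma state_star_hom w (f : A -> A) : is_state w -> star_hom f -> is_state (w \o f).
Proof.
move=> sw hf; split=> [k a b|a|] /=.
- by rewrite (star_homD hf) (star_homZ hf) (stateDr sw) (stateZ sw).
- by rewrite (star_homM hf) (star_homS hf); apply: state_ge0.
- by rewrite (star_hom_one hf) (state1 sw).
Qed.

(** The head of the word acts first, as in p(a) S_i S_m = S_i p(phi_i(a)) S_m, where p(a) crosses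
    the word from the left. *)
Definition phi_word m a := foldl (fun x i => phi i x) a m.

Lemma phi_word_star_hom m : star_hom (phi_word m).
Proof.
elim: m => [|i m IH]; first by split.
have E a : phi_word (i :: m) a = phi_word m (phi i a) by [].
split=> [k a b|a b||a]; rewrite !E.
- by rewrite (star_homD (hphi i)) (star_homZ (hphi i)) (star_homD IH) (star_homZ IH).
- by rewrite (star_homM (hphi i)) (star_homM IH).
- by rewrite (star_hom_one (hphi i)) (star_hom_one IH).
- by rewrite (star_homS (hphi i)) (star_homS IH).
Qed.

Lemma state_phi_word w m : is_state w -> is_state (w \o phi_word m).
Proof. by move=> sw; apply: state_star_hom (phi_word_star_hom m). Qed.

Lemma state_dist_ge w1 w2 a : lipschitz_ball Dom delta a ->
  ((nm (w1 a - w2 a))%:E <= state_dist Dom delta w1 w2)%E.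
Proof. by move=> ha; apply: ereal_sup_ubound; exists a. Qed.

Lemma state_dist_bounded : exists2 K : R, 0 <= K & forall w1 w2,
  is_state w1 -> is_state w2 -> (state_dist Dom delta w1 w2 <= K%:E)%E.
Proof.
(* A scalar k cancels in w1 a - w2 a, each state costs a factor 2 on a - k, and the infimum in the
   quotient norm is attained up to 1. *)
have [M hM] := hbounded; exists (4 * (`|M| + 1)); first by rewrite mulr_ge0// addr_ge0.
move=> w1 w2 s1 s2; apply: ge_ereal_sup => _ [a ha <-]; rewrite lee_fin.
have [|_ [k _ <-] hk] := @inf_adherent _ [set complex.Re `|a - k%:A| | k in [set: R[i]]] 1 ltr01.
  split; first by exists (complex.Re `|a - 0%:A|), 0.
  by exists 0 => _ [k _ <-]; apply: nm_ge0.
have hk1 : nm (a - k%:A) <= `|M| + 1.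
  have := hM a ha; have := ler_norm M; rewrite /quotient_norm => h1 h2.
  by apply: ltW; apply: lt_le_trans hk _; lra.
change (nm (w1 a - w2 a) <= 4 * (`|M| + 1)).
have -> : w1 a - w2 a = w1 (a - k%:A) - w2 (a - k%:A).
  by rewrite (stateB s1) (stateB s2) (stateZ s1) (stateZ s2) (state1 s1) (state1 s2); ring.
apply: le_trans (nmB _ _) _.
have := nm_state s1 (a - k%:A); have := nm_state s2 (a - k%:A); lra.
Qed.

(** The maximum of finitely many constants below 1. The real bound [X] lets the estimate be iterated
    along a word without products of extended reals. *)
Lemma uniform_contraction : exists c : R, [/\ 0 <= c, c < 1 &
  forall i w1 w2 (X : R), is_state w1 -> is_state w2 -> 0 <= X ->
    (state_dist Dom delta w1 w2 <= X%:E)%E ->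
    (state_dist Dom delta (w1 \o phi i) (w2 \o phi i) <= (c * X)%:E)%E].
Proof.
have [c hc] := choice hcontr; exists (\big[Num.max/0]_i c i).
have ci i : c i <= \big[Num.max/0]_i c i by apply: le_bigmax.
split; first by elim/big_ind : _ => // [x y x0 y0|i _]; [rewrite le_max x0 | case: (hc i)].
  by elim/big_ind : _ => // [x y x1 y1|i _]; [rewrite gt_max x1 | case: (hc i)].
move=> i w1 w2 X s1 s2 X0 hX; have [c0 _ h] := hc i.
apply: le_trans (h w1 w2 s1 s2) _.
apply: (@le_trans _ _ ((c i)%:E * X%:E)%E); first by apply: lee_wpmul2l.
by rewrite lee_fin ler_wpM2r.
Qed.

Definition near_scalar w k e a := forall m, size m = k ->
  nm (phi_word m a - (w (phi_word m a))%:A) <= e.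

Lemma near_scalarS w k e a : near_scalar w k.+1 e a -> forall i, near_scalar w k e (phi i a).
Proof. by move=> h i m sm; apply: (h (i :: m)) => /=; rewrite sm. Qed.

Section State.
Variables (w : A -> R[i]) (sw : is_state w).

Lemma near_scalarD k e e' a b : near_scalar w k e a -> near_scalar w k e' b ->
  near_scalar w k (e + e') (a + b).
Proof.
move=> ha hb m sm; rewrite (star_homD (phi_word_star_hom m)) (stateDr sw) scalerDl.
rewrite opprD addrACA; apply: le_trans (nmD _ _) _.
by apply: lerD; [apply: ha | apply: hb].
Qed.

Lemma near_scalarZ k e (l : R[i]) a : near_scalar w k e a -> near_scalar w k (nm l * e) (l *: a).
Proof.
move=> ha m sm; rewrite (star_homZ (phi_word_star_hom m)) (stateZ sw).
by rewrite -scalerA -scalerBr nmZ ler_wpM2l ?nm_ge0//; apply: ha.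
Qed.

Lemma near_scalar_nm k a : near_scalar w k (3 * nm a) a.
Proof.
move=> m sm; apply: le_trans (nmB _ _) _; rewrite nm_alg.
have := nm_state sw (phi_word m a); have := nm_star_hom a (phi_word_star_hom m); lra.
Qed.

(* The states of A norm its self-adjoint elements, and w1 o phi_m and w2 o phi_m
   are close for L when m is long. *)
Lemma near_scalar_dom_sa a e : Dom a -> star a = a -> 0 < e ->
  exists K, forall k, (K <= k)%N -> near_scalar w k e a.
Proof.
move=> Da sa e0; have [K K0 hK] := state_dist_bounded.
have [c [c0 c1 hc]] := uniform_contraction.
(* The element a / N lies in the Lipschitz ball; the summand 1 covers delta a = 0. *)
pose N := nm (delta a) + 1; have N0 : 0 < N by rewrite /N; have := nm_ge0 (delta a); lra.
have dist m w1 w2 : is_state w1 -> is_state w2 ->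
    (state_dist Dom delta (w1 \o phi_word m) (w2 \o phi_word m) <= (c ^+ size m * K)%:E)%E.
  move=> s1 s2; elim: m => [|i m IH]; first by rewrite expr0 mul1r; apply: hK.
  rewrite exprS -mulrA; apply: (hc i _ _ _ _ _ _ IH); last first.
  - by rewrite mulr_ge0// exprn_ge0.
  - exact: state_phi_word.
  - exact: state_phi_word.
have hba : lipschitz_ball Dom delta (N^-1%:C *: a).
  split; first exact: (star_subalgebraZ (derivation_dom hdelta)).
  rewrite (derivationZ hdelta)// nmE lecR nmZr gtr0_norm ?invr_gt0//.
  by rewrite mulrC ler_pdivrMr// mul1r /N; lra.
have [k0 hk0] := geometric_small (N * K) c0 c1 e0.
exists k0 => k /hk0 hk m sm; set b := phi_word m a.
have hm := phi_word_star_hom m.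
have sb : star b = b by rewrite -(star_homS hm) sa.
have [r wr _] := state_sa sw sb.
(* The norming state depends on the word m, but the bound on distances only on its length. *)
have [w1 s1 h1] : exists2 w1, is_state w1 & nm (b - (w b)%:A) <= nm (w1 (b - (w b)%:A)).
  by apply: state_norming; rewrite starB sb wr star_scr.
apply: le_trans h1 _; rewrite (stateB s1) (stateZ s1) (state1 s1) mulr1.
have := le_trans (state_dist_ge _ _ hba) (dist m _ _ s1 sw).
rewrite lee_fin /= (star_homZ hm) (stateZ s1) (stateZ sw) -mulrBr nmcM nmcR.
rewrite gtr0_norm ?invr_gt0// ler_pdivrMl// sm => h; apply: le_trans h _.
by rewrite (_ : N * (c ^+ k * K) = N * K * c ^+ k)//; ring.
Qed.

Lemma near_scalar_dom a e : Dom a -> 0 < e ->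
  exists K, forall k, (K <= k)%N -> near_scalar w k e a.
Proof.
move=> Da e0; have [DD DZ DS] : [/\ forall a b, Dom a -> Dom b -> Dom (a + b),
    forall (k : R[i]) a, Dom a -> Dom (k *: a) & forall a, Dom a -> Dom (star a)].
  by split; apply derivation_dom in hdelta; case: hdelta.
have Dx : Dom (re_part a) by apply: DZ; apply: DD => //; apply: DS.
have Dy : Dom (im_part a).
  by do 2!apply: (DZ); apply: DD; [apply: DS | rewrite -scaleN1r; apply: DZ].
have [K hK] := near_scalar_dom_sa Dx (re_part_sa a) (divr2_gt0 e0).
have [K' hK'] := near_scalar_dom_sa Dy (im_part_sa a) (divr2_gt0 e0).
exists (maxn K K') => k; rewrite geq_max => /andP[/hK h /hK' h'].
have := near_scalarD h (near_scalarZ 'i h').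
by rewrite re_im_part nmci mul1r -splitr.
Qed.

Lemma near_scalar_all a e : 0 < e ->
  exists K, forall k, (K <= k)%N -> near_scalar w k e a.
Proof.
(* The error a - b costs 3 e / 6 by [near_scalar_nm]; the other e / 2 goes to b. *)
move=> e0; have e6 : 0 < e / 6 by rewrite divr_gt0.
have /dense_adh/(_ a _ e6)[b Db ab] := derivation_dense hdelta.
have [K hK] := near_scalar_dom Db (divr2_gt0 e0).
exists K => k /hK hb m sm; have := near_scalarD hb (@near_scalar_nm k (a - b)).
rewrite (_ : b + (a - b) = a); last by ncring.
move=> h; apply: le_trans (h m sm) _; lra.
Qed.

End State.

End Contraction.

(** * The homomorphism from A into a Cuntz algebra *)

Section CuntzRealization.
Variables (R : realType) (A : cstarAlgType R) (n : nat) (phi : 'I_n -> A -> A).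
Hypothesis hphi : forall i, star_hom (phi i).
Variables (w : A -> R[i]) (sw : is_state w).
Hypothesis hnear : forall a e, 0 < e -> exists K, forall k, (K <= k)%N ->
  near_scalar phi w k e a.
Variables (F : cstarAlgType R) (T : 'I_n -> F).
Hypothesis cT : cuntz_family T.
Implicit Types (a b : A) (e : R).

(* The sum of w (phi_m a) T_m T_m^* over the words m of length k. *)
Fixpoint cuntz_approx k a : F :=
  if k is k'.+1 then cuntz_sum_conj T (fun i => cuntz_approx k' (phi i a)) else (w a)%:A.
Local Notation qk := cuntz_approx.

Lemma approx_linear k (l : R[i]) a b : qk k (l *: a + b) = l *: qk k a + qk k b.
Proof.
elim: k a b => [|k IH] a b /=; first by rewrite (stateDr sw) (stateZ sw) scalerDl scalerA.
rewrite sum_conjZ sum_conjD; congr cuntz_sum_conj; apply/funext => i.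
by rewrite (star_homD (hphi i)) (star_homZ (hphi i)) IH.
Qed.

Lemma approxB k a b : qk k (a - b) = qk k a - qk k b.
Proof. by rewrite [a - b]addrC -(scaleN1r b) approx_linear scaleN1r addrC. Qed.

Lemma approxZ k (l : R[i]) a : qk k (l *: a) = l *: qk k a.
Proof.
have q0 : qk k 0 = 0 by rewrite -(subrr 0) approxB subrr.
by have := approx_linear k l a 0; rewrite q0 !addr0.
Qed.

Lemma approx1 k : qk k 1 = 1.
Proof.
elim: k => [|k IH] /=; first by rewrite (state1 sw) scale1r.
rewrite -[RHS](sum_conj1 cT); congr cuntz_sum_conj; apply/funext => i.
by rewrite (star_hom_one (hphi i)).
Qed.

Lemma approx_star k a : qk k (star a) = star (qk k a).
Proof.
elim: k a => [|k IH] a /=; first by rewrite (state_star sw) starZc star1.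
rewrite sum_conj_star; congr cuntz_sum_conj; apply/funext => i.
by rewrite (star_homS (hphi i)) IH.
Qed.

Lemma nm_approx k a : nm (qk k a) <= 2 * nm a.
Proof.
elim: k a => [|k IH] a /=; first by rewrite nm_alg; have := nm_state sw a; lra.
apply: nm_sum_conj => // [|i]; first by rewrite mulr_ge0// nm_ge0.
by apply: le_trans (IH _) _; rewrite ler_wpM2l// nm_star_hom.
Qed.

(** Block-diagonality reduces the difference to the worst one over the words of length k, taken at
    phi_m(a), which is within e of a scalar. Scalars are fixed by all approximants, and 2 is the
    constant of [nm_approx]. *)
Lemma near_approx k e a m : 0 <= e -> near_scalar phi w k e a ->
  nm (qk (k + m)%N a - qk k a) <= 2 * e.
Proof.
move=> e0; elim: k a => [|k IH] a ha.
  have -> : qk (0 + m)%N a - qk 0 a = qk m (a - (w a)%:A).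
    by rewrite approxB approxZ approx1.
  by apply: le_trans (nm_approx _ _) _; rewrite ler_wpM2l//; apply: (ha [::]).
rewrite addSn /= sum_conjB; apply: nm_sum_conj => // [|i]; first by rewrite mulr_ge0.
by apply: IH; apply: near_scalarS.
Qed.

(** At k = 0 write a = w(a) + c with nm c <= e. The scalar part is exactly multiplicative, and c
    contributes at most 2 nm (c b) + (2 nm c)(2 nm b), whence 6. *)
Lemma near_approxM k e a b m : 0 <= e -> near_scalar phi w k e a ->
  nm (qk (k + m)%N (a * b) - qk (k + m)%N a * qk (k + m)%N b) <= 6 * e * nm b.
Proof.
move=> e0; elim: k a b => [|k IH] a b ha.
  rewrite add0n; pose c := a - (w a)%:A.
  have hc : nm c <= e by apply: (ha [::]).
  have -> : qk m (a * b) - qk m a * qk m b = qk m (c * b) - qk m c * qk m b.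
    rewrite /c mulrBl !approxB -scalerAl mul1r !approxZ approx1 mulrBl -scalerAl mul1r.
    by rewrite opprB addrA subrK.
  apply: le_trans (nmB _ _) _.
  have := nm_approx m (c * b); have := nm_approx m b; have := nm_approx m c.
  have := nmM c b; have := nmM (qk m c) (qk m b).
  have := nm_ge0 b; have := nm_ge0 (qk m c); have := nm_ge0 (qk m b).
  have := nm_ge0 c.
  set x := nm c in hc *; set y := nm b; set z := nm (qk m c); set v := nm (qk m b).
  move=> x0 v0 z0 y0 h1 h2 hz hv h3.
  have : z * v <= (2 * x) * (2 * y) by apply: ler_pM.
  have : x * y <= e * y by apply: ler_wpM2r.
  lra.
rewrite addSn /= (sum_conjM cT) sum_conjB; apply: nm_sum_conj => // [|i].
  by rewrite !mulr_ge0// nm_ge0.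
rewrite (star_homM (hphi i)); apply: le_trans (IH _ _ (near_scalarS ha i)) _.
by rewrite ler_wpM2l ?mulr_ge0// nm_star_hom.
Qed.

Lemma cuntz_realization : exists q : A -> F,
  [/\ star_hom q, forall a, tends (fun k => qk k a) (q a) &
      forall i a, q a * T i = T i * q (phi i a)].
Proof.
have cv a : exists x, tends (fun k => qk k a) x.
  apply: tends_complete => e e0; have [K hK] := hnear a (divr2_gt0 e0).
  exists K => k m /hK h; have := near_approx m (ltW (divr2_gt0 e0)) h; lra.
have [q hq] := choice cv; exists q.
split; [split=> [l a b|a b||a]|exact: hq|].
- apply: (tends_unique (hq _)); apply: (@tends_eq _ _ (fun k => l *: qk k a + qk k b)).
    by move=> k; rewrite approx_linear.
  by apply: tendsD => //; apply: tendsZ.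
- have qM : tends (fun k => qk k (a * b) - qk k a * qk k b) (q (a * b) - q a * q b).
    apply: tendsD => //.
    apply: (@tends_eq _ _ (fun k => -1 *: (qk k a * qk k b))); first by move=> k; rewrite scaleN1r.
    by rewrite -[- (q a * q b)]scaleN1r; apply: tendsZ; apply: tendsM.
  apply/eqP; rewrite -subr_eq0; apply/eqP/(tends_unique qM) => e e0.
  have b0 : 0 < 6 * (nm b + 1) by rewrite mulr_gt0// ltr_wpDl ?nm_ge0.
  have e0' : 0 < e / (6 * (nm b + 1)) by rewrite divr_gt0.
  have [K hK] := hnear a e0'; exists K => k /hK h; rewrite subr0.
  have := near_approxM b 0 (ltW e0') h; rewrite addn0 => h1; apply: le_trans h1 _.
  rewrite -mulrA mulrCA; set t := nm b; have t0 : 0 <= t := nm_ge0 b.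
  have -> : e / (6 * (t + 1)) * (6 * t) = e * (t / (t + 1)).
    by field; rewrite gt_eqF//; lra.
  by rewrite ler_piMr ?(ltW e0)// ler_pdivrMr ?mul1r; lra.
- apply: (tends_unique (hq _)); apply: (@tends_eq _ _ (fun=> 1 : F)); last exact: tends_cst.
  by move=> k; rewrite approx1.
- apply: (tends_unique (hq _)); apply: (@tends_eq _ _ (fun k => star (qk k a))).
    by move=> k; rewrite approx_star.
  exact: tends_star.
(* One step of the recursion is exactly covariance: qk (k + 1) a times T_i is T_i times qk k (phi_i
   a). *)
- move=> i a; apply: (@tends_unique _ _ (fun k => qk (k + 1)%N a * T i)).
    by apply: tendsM (tends_shift _ (hq a)) (tends_cst _).
  apply: (@tends_eq _ _ (fun k => T i * qk k (phi i a))).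
    by move=> k; rewrite addn1 /= (sum_conj_mulS cT).
  by apply: tendsM => //; apply: tends_cst.
Qed.

(** By covariance and the sum relation, p(a) satisfies the recursion that defines the approximants,
    so the error is that of the base case at phi_m(a). *)
Lemma covariant_approx (p : A -> F) a : covariant_pair phi p T ->
  tends (fun k => qk k a) (p a).
Proof.
move=> hp e e0; have [K hK] := hnear a e0; exists K => k /hK.
elim: k a {hK} => [|k IH] a ha.
  rewrite /= nmC -(star_hom_alg (covariant_hom hp)) -(star_homB (covariant_hom hp)).
  exact: le_trans (nm_star_hom _ (covariant_hom hp)) (ha [::] erefl).
have -> : p a = cuntz_sum_conj T (fun i => p (phi i a)).
  rewrite -[LHS]mulr1 -(cuntz_sum cT) mulr_sumr; apply: eq_bigr => i _.
  by rewrite mulrA (covariant_rel hp).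
rewrite /= sum_conjB; apply: nm_sum_conj (ltW e0) _ => // i.
by apply: IH; apply: near_scalarS.
Qed.

End CuntzRealization.

(** * Generated C*-subalgebras *)

Section Generation.
Variables (R : realType) (E : cstarAlgType R).

Lemma star_hom_comp (A B C : cstarAlgType R) (f : A -> B) (g : B -> C) :
  star_hom f -> star_hom g -> star_hom (g \o f).
Proof.
move=> hf hg; split=> [k a b|a b||a] /=.
- by rewrite (star_hom_linear hf) (star_hom_linear hg).
- by rewrite (star_homM hf) (star_homM hg).
- by rewrite (star_hom_one hf) (star_hom_one hg).
- by rewrite (star_homS hf) (star_homS hg).
Qed.

Lemma cstar_generated_min (X D : set E) : cstar_generated X = setT ->
  star_subalgebra D -> (forall x, adh D x -> D x) -> X `<=` D -> forall x, D x.
Proof.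
move=> gX sD cD XD x; have : cstar_generated X x by rewrite gX.
by apply; split => //; apply/closed_adh.
Qed.

(** The equalizer is a star subalgebra, closed because homomorphisms are contractive. *)
Lemma star_hom_generated_eq (F : cstarAlgType R) (X : set E) (f g : E -> F) :
  cstar_generated X = setT -> star_hom f -> star_hom g ->
  (forall x, X x -> f x = g x) -> forall x, f x = g x.
Proof.
move=> gX hf hg fg; apply: (cstar_generated_min gX) => //.
  split=> [|a b|k a|a b|a] /=.
  - by rewrite (star_hom0 hf) (star_hom0 hg).
  - by rewrite (star_homD hf) (star_homD hg) => -> ->.
  - by rewrite (star_homZ hf) (star_homZ hg) => ->.
  - by rewrite (star_homM hf) (star_homM hg) => -> ->.
  - by rewrite (star_homS hf) (star_homS hg) => ->.
move=> x /adh_seq[u fu ux]; apply: (@tends_unique _ _ (fun n => f (u n))).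
  by apply: tends_lip ux => y z; apply: star_hom_lip.
apply: (@tends_eq _ _ (fun n => g (u n))); first by move=> m; rewrite fu.
by apply: tends_lip ux => y z; apply: star_hom_lip.
Qed.

Lemma star_subalgebra_adh (D : set E) : star_subalgebra D -> star_subalgebra (adh D).
Proof.
move=> [D0 DD DZ DM DS]; split=> [|a b|k a|a b|a]; first exact: adh_sub.
- move=> /adh_seq[u Du ua] /adh_seq[v Dv vb].
  by apply: adh_tends (tendsD ua vb) => m; apply: DD.
- by move=> /adh_seq[u Du ua]; apply: adh_tends (tendsZ k ua) => m; apply: DZ.
- move=> /adh_seq[u Du ua] /adh_seq[v Dv vb].
  by apply: adh_tends (tendsM ua vb) => m; apply: DM.
- by move=> /adh_seq[u Du ua]; apply: adh_tends (tends_star ua) => m; apply: DS.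
Qed.

Lemma cstar_generated_star_subalgebra (X : set E) : star_subalgebra (cstar_generated X).
Proof.
split=> [D []//|a b ha hb D hD|k a ha D hD|a b ha hb D hD|a ha D hD].
- by case.
- by case: (hD) => sD _ _; apply: (star_subalgebraD sD); [apply: ha | apply: hb].
- by case: (hD) => sD _ _; apply: (star_subalgebraZ sD); apply: ha.
- by case: (hD) => sD _ _; apply: (star_subalgebraM sD); [apply: ha | apply: hb].
- by case: (hD) => sD _ _; apply: (star_subalgebra_star sD); apply: ha.
Qed.

Lemma cstar_generated_adh (X : set E) x : adh (cstar_generated X) x -> cstar_generated X x.
Proof.
move=> hx D hD; case: (hD) => _ /closed_adh cD _; apply: cD => e /hx[y Xy xy].
by exists y => //; apply: Xy.
Qed.

Lemma sub_cstar_generated (X : set E) : X `<=` cstar_generated X.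
Proof. by move=> x Xx D [_ _]; apply. Qed.

End Generation.

(** * Entire functions and the identity theorem *)

Section Entire.
Variables (R : realType) (E : cstarAlgType R).
Implicit Types (x y : E) (c e u : nat -> E) (t s k : R) (z : R[i]) (f h : R[i] -> E).

Definition cis t : R[i] := cos t +i* sin t.

Lemma cisD t s : cis (t + s) = cis t * cis s.
Proof. by apply/eqP; rewrite eq_complex /= cosD sinD eqxx /= addrC; apply/eqP; ring. Qed.

Lemma cis0 : cis 0 = 1.
Proof. by apply/eqP; rewrite eq_complex /= cos0 sin0 !eqxx. Qed.

Lemma cisN_conj t : conjc (cis t) = cis (- t).
Proof. by rewrite /cis cosN sinN. Qed.

Lemma cis_norm t : `|cis t| = 1.
Proof. by rewrite normc_def /= cos2Dsin2 sqrtr1. Qed.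

Lemma nm_cis t : nm (cis t) = 1.
Proof. by rewrite /nm cis_norm. Qed.

Lemma cis_pi_odd n : odd n -> cis (pi * n%:R) = -1.
Proof.
move=> on; have cpi : cis pi = -1.
  by rewrite /cis cospi sinpi; apply/eqP; rewrite eq_complex /= oppr0 !eqxx.
have -> : cis (pi * n%:R) = cis pi ^+ n.
  elim: n {on} => [|n IH]; first by rewrite mulr0 cis0 expr0.
  by rewrite exprS -natr1 mulrDr mulr1 cisD IH mulrC.
by rewrite cpi -signr_odd on expr1.
Qed.

Lemma expi_coeff t n : ('i * t%:C) ^+ n * (n`!%:R^-1)%:C = cos_coeff t n +i* sin_coeff t n.
Proof.
rewrite exprMn -rmorphXn -mulrA -rmorphM /=.
have -> : 'i ^+ n = (if odd n then 'i else 1) * ((-1) ^+ n./2)%:C :> R[i].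
  rewrite -{1}(odd_double_half n) exprD -muln2 mulnC exprM expr2 mulii rmorphXn rmorphN1.
  by case: (odd n); rewrite ?expr1 ?expr0.
rewrite -mulrA -rmorphM /= /cos_coeff /sin_coeff /=.
have h : (odd n)%:R * (-1) ^+ n.-1./2 * t ^+ n / n`!%:R =
    (odd n)%:R * (-1) ^+ n./2 * t ^+ n / n`!%:R :> R.
  by case: n => //= n; rewrite uphalf_half; case: (odd n); rewrite /= ?mul0r ?add0n.
rewrite h -exprnP; case: (odd n) => /=; apply/eqP; rewrite eq_complex /=.
  by rewrite ?(mul0r, mul1r, mulr0) ?(subr0, addr0, add0r) ?oppr0 ?mulrA !eqxx.
by rewrite ?(mul0r, mul1r, mulr0) ?(subr0, addr0, add0r) ?oppr0 ?mulrA !eqxx.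
Qed.

Lemma series0 (V : zmodType) (u : nat -> V) : series u 0%N = 0.
Proof. by rewrite /series /= big_geq. Qed.

Lemma seriesS (V : zmodType) (u : nat -> V) n : series u n.+1 = series u n + u n.
Proof. by rewrite /series /= big_nat_recr. Qed.

Lemma nm_series_diff u (v : nat -> R) n m : (forall i, nm (u i) <= v i) ->
  nm (series u (n + m)%N - series u n) <= series v (n + m)%N - series v n.
Proof.
move=> uv; elim: m => [|m IH]; first by rewrite addn0 !subrr nm0.
rewrite addnS !seriesS.
have -> : series u (n + m)%N + u (n + m)%N - series u n =
  (series u (n + m)%N - series u n) + u (n + m)%N by ncring.
by apply: le_trans (nmD _ _) _; have := uv (n + m)%N; lra.
Qed.

Lemma tends_series u (v : nat -> R) : (forall i, nm (u i) <= v i) ->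
  cvgn (series v) -> exists x, tends (series u) x.
Proof.
move=> uv /cvgrPdist_le hv; apply: tends_complete => e e0.
have [N _ hN] := hv _ (divr2_gt0 e0).
exists N => n m Nn; apply: le_trans (nm_series_diff _ _ uv) _.
have := hN n Nn; have := hN (n + m)%N (leq_trans Nn (leq_addr _ _)).
rewrite /= !ler_norml => /andP[h1 h2] /andP[h3 h4]; lra.
Qed.

Lemma nm_le_ReIm z : nm z <= `|complex.Re z| + `|complex.Im z|.
Proof.
rewrite [in leLHS](complexE z); apply: le_trans (nmD _ _) _.
rewrite nmcM !nmcR.
have -> : nm ('i : R[i]) = 1 := nmci _.
by rewrite mul1r.
Qed.

(** The terms of exp(i k z) x, with z^n split off because [entire] asks for coefficients independent
    of z. *)
Definition exp_series k x z n := z ^+ n *: ((('i * k%:C) ^+ n * (n`!%:R^-1)%:C) *: x).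

Lemma exp_seriesE k x z n : exp_series k x z n = ((z * 'i * k%:C) ^+ n * (n`!%:R^-1)%:C) *: x.
Proof. by rewrite /exp_series scalerA mulrA -exprMn mulrA. Qed.

Lemma exp_series_real k x t : tends (series (exp_series k x t%:C)) (cis (t * k) *: x).
Proof.
pose y := t * k.
have hs n : series (exp_series k x t%:C) n =
    (series (cos_coeff y) n +i* series (sin_coeff y) n) *: x.
  elim: n => [|n IH]; first by rewrite !series0 scale0r.
  rewrite seriesS IH exp_seriesE (mulrC t%:C) -mulrA -rmorphM /= -/y expi_coeff -scalerDl.
  by rewrite !seriesS.
apply: (tends_eq (fun n => esym (hs n))) => e e0.
pose K := 2 * (nm x + 1); have K0 : 0 < K by rewrite mulr_gt0// ltr_wpDl ?nm_ge0.
have eK : 0 < e / K by rewrite divr_gt0.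
have hcos : series (cos_coeff y) @ \oo --> cos y.
  by rewrite cos.unlock; apply: is_cvg_series_cos_coeff.
have hsin : series (sin_coeff y) @ \oo --> sin y.
  by rewrite sin.unlock; apply: is_cvg_series_sin_coeff.
have [N _ hN] := (cvgrPdist_le _ _).1 hcos _ eK.
have [M _ hM] := (cvgrPdist_le _ _).1 hsin _ eK.
exists (maxn N M) => n; rewrite geq_max => /andP[/hN h1 /hM h2].
rewrite -scalerBl nmZ.
have h3 : nm (series (cos_coeff y) n +i* series (sin_coeff y) n - cis (t * k)) <= e / K + e / K.
  apply: le_trans (nm_le_ReIm _) _.
  by apply: lerD; rewrite /= distrC; [apply: h1|apply: h2].
apply: (@le_trans _ _ ((e / K + e / K) * (nm x + 1))).
  by apply: ler_pM; rewrite ?nm_ge0// lerDl.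
by rewrite le_eqVlt; apply/orP; left; apply/eqP; rewrite /K; field; rewrite gt_eqF// ltr_wpDl ?nm_ge0.
Qed.

Lemma exp_series_imag k x t :
  tends (series (exp_series k x (0 +i* t))) ((expR (- (t * k)))%:C *: x).
Proof.
pose y := - (t * k).
have it : (0 +i* t) * 'i * k%:C = y%:C.
  by apply/eqP; rewrite eq_complex /= /y; apply/andP; split; apply/eqP; ring.
have hs n : series (exp_series k x (0 +i* t)) n = (series (exp_coeff y) n)%:C *: x.
  elim: n => [|n IH]; first by rewrite !series0 scale0r.
  rewrite seriesS IH exp_seriesE it -rmorphXn -rmorphM /= -scalerDl -rmorphD /=.
  by rewrite !seriesS.
apply: (tends_eq (fun n => esym (hs n))) => e e0.
have K0 : 0 < nm x + 1 by rewrite ltr_wpDl ?nm_ge0.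
have eK : 0 < e / (nm x + 1) by rewrite divr_gt0.
have := @is_cvg_series_exp_coeff _ y => /cvgrPdist_le/(_ _ eK)[N _ hN].
exists N => n /hN h; rewrite -scalerBl nmZ -rmorphB nmcR distrC.
apply: (@le_trans _ _ ((e / (nm x + 1)) * (nm x + 1))).
  by apply: ler_pM; rewrite ?nm_ge0// lerDl.
by rewrite divfK// gt_eqF.
Qed.

(** The extension attached to an element of gauge degree k. Two axes matter: the real one, where it
    is the flow, and the imaginary one, where the KMS condition is read. *)
Lemma entire_exp k x : exists f, [/\ entire f, forall t, f t%:C = cis (t * k) *: x &
  forall t, f (0 +i* t) = (expR (- (t * k)))%:C *: x].
Proof.
have cv z : exists y, tends (series (exp_series k x z)) y.
  apply: (tends_series (v := fun n => exp_coeff (nm z * `|k|) n * nm x)).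
    move=> n; rewrite exp_seriesE nmZ ler_wpM2r ?nm_ge0// nmcM nmcR.
    rewrite [`|_|]ger0_norm ?invr_ge0// /exp_coeff /= ler_wpM2r ?invr_ge0//.
    have nmX w : nm (w ^+ n : R[i]) = nm w ^+ n.
      elim: n => [|j IH]; first by rewrite !expr0 /nm normr1.
      by rewrite !exprS nmcM IH.
    rewrite nmX !nmcM nmcR.
    have -> : nm ('i : R[i]) = 1 := nmci _.
    by rewrite mulr1.
  rewrite (_ : (fun _ => _) = nm x *: exp_coeff (nm z * `|k|)); last first.
    by apply/funext => n /=; rewrite mulrC.
  by apply: is_cvg_seriesZ; apply: is_cvg_series_exp_coeff.
have [f hf] := choice cv; exists f; split.
- exists (fun n => (('i * k%:C) ^+ n * (n`!%:R^-1)%:C) *: x) => z.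
  by apply/tends_cvg; apply: hf.
- by move=> t; apply: (tends_unique (hf _)); apply: exp_series_real.
- by move=> t; apply: (tends_unique (hf _)); apply: exp_series_imag.
Qed.

Lemma entire_comp f (L : E -> E) K : (forall x y, L (x + y) = L x + L y) ->
  (forall z x, L (z *: x) = z *: L x) -> (forall x y, nm (L x - L y) <= K * nm (x - y)) ->
  entire f -> entire (L \o f).
Proof.
move=> LD LZ Ll [c hc]; exists (L \o c) => z; apply/tends_cvg.
have L0 : L 0 = 0 by have := LZ 0 0; rewrite !scale0r.
apply: (@tends_eq _ _ (fun n => L (series (fun j => z ^+ j *: c j) n))).
  by elim=> [|n IH]; rewrite ?series0// !seriesS LD IH LZ.
by apply: tends_lip Ll _; apply/tends_cvg.
Qed.

Lemma entire_lin f h z : entire f -> entire h -> entire (fun w => z *: f w + h w).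
Proof.
move=> [c hc] [c' hc']; exists (fun n => z *: c n + c' n) => w; apply/tends_cvg.
apply: (@tends_eq _ _ (fun n => z *: series (fun j => w ^+ j *: c j) n +
    series (fun j => w ^+ j *: c' j) n)).
  elim=> [|n IH]; first by rewrite !series0 scaler0 addr0.
  by rewrite !seriesS -IH !scalerDr !scalerA (mulrC z) addrACA.
by apply: tendsD; [apply: tendsZ|]; apply/tends_cvg.
Qed.

(** Once the lower coefficients vanish, divide by t^m and let t tend to 0. Convergence at t = 1
    bounds all coefficients by some M, so the tail after t^m c_m is at most 2 M t^(m+1) for t <=
    1/2. *)
Lemma series_coeff0 c : (forall t, tends (series (fun n => t%:C ^+ n *: c n)) 0) ->
  forall n, c n = 0.
Proof.
move=> hc; elim/ltn_ind => m IH.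
have [M hM] : exists M, forall n, nm (c n) <= M.
  have [N hN] := hc 1 1 ltr01.
  pose M0 := \big[Num.max/0]_(i < N) nm (c i).
  (* From index N on, two consecutive partial sums at t = 1 have norm at most 1, so their difference
     c_n has norm at most 2. *)
  exists (Num.max M0 2) => n; rewrite le_max; have [nN|nN] := ltnP n N.
    by apply/orP; left; apply: (le_bigmax _ (fun i : 'I_N => nm (c i)) (Ordinal nN)).
  apply/orP; right; have := hN n nN; have := hN n.+1 (leqW nN); rewrite seriesS !subr0.
  rewrite rmorph1 expr1n scale1r.
  set X := series _ n => h1 h2.
  rewrite -(addKr X (c n)) addrC; apply: le_trans (nmB _ _) _; lra.
have M0 : 0 <= M := le_trans (nm_ge0 _) (hM 0%N).
have key t : 0 < t -> t <= 2^-1 -> nm (c m) <= 2 * M * t.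
  move=> t0 t1.
  have tm : 0 < t ^+ m by rewrite exprn_gt0.
  have hlow j : (j <= m)%N -> series (fun n => t%:C ^+ n *: c n) j = 0.
    elim: j => [|j IHj] jm; first by rewrite series0.
    by rewrite seriesS IHj ?(ltnW jm)// IH// scaler0 addr0.
  (* As t <= 1/2, a new term is at most M t^j <= 2 M (t^j - t^(j+1)), and the bound telescopes. *)
  have hhigh i : nm (series (fun n => t%:C ^+ n *: c n) (m.+1 + i)%N - t%:C ^+ m *: c m) <=
      2 * M * (t ^+ m.+1 - t ^+ (m.+1 + i)).
    elim: i => [|i IHi].
      by rewrite addn0 seriesS hlow// add0r !subrr nm0 mulr0.
    rewrite addnS seriesS addrAC; apply: le_trans (nmD _ _) _.
    set j := (m.+1 + i)%N in IHi *.
    have tj : 0 < t ^+ j by rewrite exprn_gt0.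
    have hj : nm (t%:C ^+ j *: c j) <= M * t ^+ j.
      by rewrite -rmorphXn nmZr gtr0_norm// mulrC ler_pM2r.
    have h : 0 <= M * t ^+ j * (1 - 2 * t).
      by rewrite mulr_ge0 ?mulr_ge0 ?(ltW tj)//; lra.
    rewrite (exprSr t j); lra.
  have : nm (0 - t%:C ^+ m *: c m) <= 2 * M * t ^+ m.+1.
    apply: nm_tends_le (hc t); exists m.+1 => n mn.
    rewrite -(subnKC mn); apply: le_trans (hhigh _) _.
    by rewrite ler_wpM2l ?mulr_ge0// gerBl exprn_ge0// ltW.
  rewrite sub0r nmN -rmorphXn nmZr gtr0_norm// exprS mulrA (mulrC _ (t ^+ m)).
  by rewrite ler_pM2l.
apply: nm_eq0; apply/eqP; rewrite eq_le nm_ge0 andbT; apply: le_eps => e e0.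
have M1 : 0 < 2 * M + 1 by lra.
pose t := Num.min 2^-1 (e / (2 * M + 1)).
have t0 : 0 < t by rewrite lt_min invr_gt0 ltr0n divr_gt0.
have t1 : t <= 2^-1 by rewrite ge_min lexx.
have tM : t * (2 * M + 1) <= e by rewrite -ler_pdivlMr// ge_min lexx orbT.
by apply: le_trans (key t t0 t1) _; lra.
Qed.

Lemma entire_unique f h : entire f -> entire h ->
  (forall t, f t%:C = h t%:C) -> forall z, f z = h z.
Proof.
move=> ef eh fh z.
have [c hc] := entire_lin (-1) ef eh.
have c0 n : c n = 0.
  apply: series_coeff0 => t; have /tends_cvg := hc t%:C.
  by rewrite fh scaleN1r addNr.
have /tends_cvg hz := hc z; apply/eqP; rewrite eq_sym -subr_eq0 addrC -scaleN1r; apply/eqP.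
apply: (tends_unique hz); apply: (@tends_eq _ _ (fun=> 0 : E)); last exact: tends_cst.
by elim=> [|n IH]; rewrite ?series0// seriesS -IH add0r c0 scaler0.
Qed.

End Entire.

(** * Limits of uniformly Lipschitz maps *)

Section DenseConvergence.
Variables (R : realType) (V : normedModType R[i]) (W : completeNormedModType R[i]).
Variables (U : nat -> V -> W) (K : R).
Hypothesis U_lip : forall n x y, nm (U n x - U n y) <= K * nm (x - y).

Lemma tends_dense (D : set V) x : (forall y, D y -> exists l, tends (fun n => U n y) l) ->
  adh D x -> exists l, tends (fun n => U n x) l.
Proof.
move=> hD hx; apply: tends_complete => e e0.
pose K' := `|K| + 1; have K0 : 0 < K' by rewrite ltr_wpDl.
have e4 : 0 < e / 4 by rewrite divr_gt0.
have eK : 0 < e / (4 * K') by rewrite divr_gt0// mulr_gt0.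
have [y Dy xy] := hx _ eK; have [l hl] := hD y Dy; have [N hN] := hl _ e4.
have Kxy : K * nm (x - y) <= e / 4.
  apply: (@le_trans _ _ (K' * (e / (4 * K')))).
    apply: (@le_trans _ _ (K' * nm (x - y))).
      by rewrite ler_wpM2r ?nm_ge0// /K'; have := ler_norm K; lra.
    by rewrite ler_wpM2l// ltW.
  by rewrite le_eqVlt; apply/orP; left; apply/eqP; field; rewrite gt_eqF.
exists N => n m Nn; have h1 := hN n Nn; have h2 := hN (n + m)%N (leq_trans Nn (leq_addr _ _)).
have := le_trans (U_lip (n + m) x y) Kxy; have := le_trans (U_lip n x y) Kxy.
rewrite (nmC (U n x)) => h3 h4.
apply: le_trans (nm_triangle (U (n + m)%N y) _ _) _.
have := nm_triangle l (U (n + m)%N y) (U n x).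
have := nm_triangle (U n y) l (U n x); rewrite (nmC l (U n y)); lra.
Qed.

Lemma tends_limit_lip (T : V -> W) : (forall x, tends (fun n => U n x) (T x)) ->
  forall x y, nm (T x - T y) <= K * nm (x - y).
Proof.
move=> hT x y; apply: (@nm_tends _ _ (fun n => U n x - U n y)); first by move=> n; apply: U_lip.
apply: tendsD => //; apply: (@tends_eq _ _ (fun n => -1 *: U n y)).
  by move=> n; rewrite scaleN1r.
by rewrite -[- T y]scaleN1r; apply: tendsZ.
Qed.

End DenseConvergence.

Lemma adh_eq (R : realType) (V W : normedModType R[i]) (D : set V) (f g : V -> W) (K L : R) :
  (forall x y, nm (f x - f y) <= K * nm (x - y)) ->
  (forall x y, nm (g x - g y) <= L * nm (x - y)) ->
  (forall x, D x -> f x = g x) -> forall x, adh D x -> f x = g x.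
Proof.
move=> hf hg fg x /adh_seq[u Du ux].
apply: (@tends_unique _ _ (fun n => f (u n))); first exact: tends_lip hf ux.
apply: (@tends_eq _ _ (fun n => g (u n))); first by move=> n; rewrite fg.
exact: tends_lip hg ux.
Qed.

(** * Words in a Cuntz family and the canonical state *)

Section CuntzWords.
Variables (R : realType) (n : nat) (E : cstarAlgType R) (S : 'I_n -> E).
Hypothesis cS : cuntz_family S.
Hypothesis gS : cstar_generated (range S) = setT.
Hypothesis n2 : (2 <= n)%N.
Implicit Types (x y : E) (al be m : seq 'I_n).

Definition cuntz_word m : E := foldr (fun i x => S i * x) 1 m.
Local Notation Sw := cuntz_word.

Lemma cuntz_word_rcons m i : Sw (rcons m i) = Sw m * S i.
Proof. by elim: m => [|j m IH] /=; rewrite ?mulr1 ?mul1r// IH mulrA. Qed.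

Lemma star_mul1S (i : 'I_n) : star (S i) * S i = 1.
Proof. exact: cuntz_isometry cS i. Qed.

Lemma sum_S_star : \sum_i S i * star (S i) = 1.
Proof. exact: cuntz_sum cS. Qed.

Lemma nm_S i : nm (S i) = 1.
Proof. exact: nm_unitary (star_mul1S i). Qed.

Lemma nm_cuntz_word m : nm (Sw m) <= 1.
Proof.
elim: m => [|i m IH] /=; first by rewrite nm1.
by apply: le_trans (nmM _ _) _; rewrite nm_S mul1r.
Qed.

(** The relations reduce products of these monomials to monomials or 0, so the span is a star
    algebra, dense because the family generates. The inductive form allows arguments by cases on a
    monomial. *)
Inductive cuntz_span : E -> Prop :=
| span_word al be : cuntz_span (Sw al * star (Sw be))
| span0 : cuntz_span 0
| spanD x y : cuntz_span x -> cuntz_span y -> cuntz_span (x + y)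
| spanZ (k : R[i]) x : cuntz_span x -> cuntz_span (k *: x).

Lemma span_mulSl i x : cuntz_span x -> cuntz_span (S i * x).
Proof.
elim=> [al be||y z _ hy _ hz|k y _ hy].
- by rewrite mulrA; apply: (span_word (i :: al)).
- by rewrite mulr0; apply: span0.
- by rewrite mulrDr; apply: spanD.
- by rewrite -scalerAr; apply: spanZ.
Qed.

Lemma span_mul_starSl i x : cuntz_span x -> cuntz_span (star (S i) * x).
Proof.
elim=> [[|j al] be||y z _ hy _ hz|k y _ hy].
- by rewrite mul1r -starMr -cuntz_word_rcons -[star _]mul1r; apply: (span_word [::]).
- rewrite /= !mulrA (cuntz_orthogonal cS); case: eqP => _.
    by rewrite mul1r; apply: span_word.
  by rewrite !mul0r; apply: span0.
- by rewrite mulr0; apply: span0.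
- by rewrite mulrDr; apply: spanD.
- by rewrite -scalerAr; apply: spanZ.
Qed.

Lemma span_star x : cuntz_span x -> cuntz_span (star x).
Proof.
elim=> [al be||y z _ hy _ hz|k y _ hy].
- by rewrite starMr starK; apply: span_word.
- by rewrite star0; apply: span0.
- by rewrite starDr; apply: spanD.
- by rewrite starZc; apply: spanZ.
Qed.

Lemma spanM x y : cuntz_span x -> cuntz_span y -> cuntz_span (x * y).
Proof.
move=> hx hy; elim: hx => [al be||x1 x2 _ h1 _ h2|k x1 _ h1].
- have : cuntz_span (star (Sw be) * y).
    elim: be y hy => [|i be IH] y hy /=; first by rewrite star1 mul1r.
    by rewrite starMr -mulrA; apply/IH/span_mul_starSl.
  rewrite -mulrA; move: (star _ * y) => z; elim: al => [|i al IH] hz /=; first by rewrite mul1r.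
  by rewrite -mulrA; apply/span_mulSl/IH.
- by rewrite mul0r; apply: span0.
- by rewrite mulrDl; apply: spanD.
- by rewrite -scalerAl; apply: spanZ.
Qed.

Lemma span_star_subalgebra : star_subalgebra cuntz_span.
Proof.
by split; [exact: span0|exact: spanD|move=> k a; exact: spanZ|exact: spanM|exact: span_star].
Qed.

Lemma span_adh x : adh cuntz_span x.
Proof.
apply: (cstar_generated_min gS (star_subalgebra_adh span_star_subalgebra)).
  exact: adh_adh.
move=> _ [i _ <-]; apply: adh_sub.
by have := span_word [:: i] [::]; rewrite /= star1 !mulr1.
Qed.

Definition cuntz_mean x : E := n%:R^-1%:C *: \sum_i star (S i) * x * S i.
Local Notation Psi := cuntz_mean.

Let n0 : 0 < n%:R :> R.
Proof. by rewrite ltr0n (leq_trans _ n2). Qed.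

Lemma mean_linear (k : R[i]) x y : Psi (k *: x + y) = k *: Psi x + Psi y.
Proof.
rewrite /Psi scalerA mulrC -scalerA -scalerDr; congr (_ *: _).
rewrite scaler_sumr -big_split; apply: eq_bigr => i _ /=.
by rewrite mulrDr mulrDl -scalerAr -scalerAl.
Qed.

Lemma mean_star x : Psi (star x) = star (Psi x).
Proof.
rewrite /Psi starZr star_sum; congr (_ *: _); apply: eq_bigr => i _.
by rewrite !starMr starK mulrA.
Qed.

Lemma mean1 : Psi 1 = 1.
Proof.
rewrite /Psi (eq_bigr (fun=> 1)) => [|i _]; last by rewrite mulr1 star_mul1S.
rewrite sumr_const card_ord (_ : 1 *+ n = n%:R%:C *: 1); last by rewrite rmorph_nat scaler_nat.
by rewrite scalerr mulVf ?gt_eqF// scale1r.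
Qed.

Lemma nm_mean x : nm (Psi x) <= nm x.
Proof.
rewrite /Psi nmZr gtr0_norm ?invr_gt0// mulrC ler_pdivrMr//.
apply: le_trans (nm_sum _) _.
apply: (@le_trans _ _ (\sum_(i < n) nm x)); last by rewrite sumr_const card_ord mulr_natr.
apply: ler_sum => i _; apply: le_trans (nmM _ _) _; rewrite nm_S mulr1.
by apply: le_trans (nmM _ _) _; rewrite nm_star nm_S mul1r.
Qed.

Lemma mean_pos x : pos x -> pos (Psi x).
Proof.
move=> px; apply: posZ; first by rewrite invr_ge0 ltW.
apply: pos_sum => i; apply: pos_eps => e e0.
have [v [sv _ _ hv]] := pos_sqrt px e0.
have -> : star (S i) * x * S i + e%:C *: 1 = star (v * S i) * (v * S i).
  rewrite starMr sv [RHS]mulrA -(mulrA (star _) v v) hv mulrDr mulrDl; congr (_ + _).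
  by rewrite -scalerAr mulr1 -scalerAl star_mul1S.
exact: pos_star_mul.
Qed.

Lemma mean_word i j x : Psi (S i * x * star (S j)) = ((i == j)%:R / n%:R)%:C *: x.
Proof.
rewrite /Psi (bigD1 i)//= big1 ?addr0 => [|k ki]; last first.
  by rewrite !mulrA (cuntz_orthogonal cS) (negbTE ki) !mul0r.
rewrite !mulrA star_mul1S mul1r -mulrA (cuntz_orthogonal cS) eq_sym.
case: eqP => _; first by rewrite mulr1 mul1r.
by rewrite mulr0 scaler0 mul0r scale0r.
Qed.

Lemma mean_wordl i x : Psi (S i * x) = n%:R^-1%:C *: (x * S i).
Proof.
rewrite /Psi (bigD1 i)//= big1 ?addr0 => [|k ki]; last first.
  by rewrite !mulrA (cuntz_orthogonal cS) (negbTE ki) !mul0r.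
by rewrite !mulrA star_mul1S mul1r.
Qed.

Lemma iter_mean_linear N (k : R[i]) x y :
  iter N Psi (k *: x + y) = k *: iter N Psi x + iter N Psi y.
Proof. by elim: N => //= N ->; rewrite mean_linear. Qed.

Lemma iter_mean0 N : iter N Psi 0 = 0.
Proof. by have := iter_mean_linear N (-1) 0 0; rewrite scaler0 addr0 scaleN1r addNr. Qed.

Lemma iter_meanZ N (k : R[i]) x : iter N Psi (k *: x) = k *: iter N Psi x.
Proof. by have := iter_mean_linear N k x 0; rewrite iter_mean0 !addr0. Qed.

Lemma iter_mean_lip N x y : nm (iter N Psi x - iter N Psi y) <= 1 * nm (x - y).
Proof.
rewrite mul1r -(scaleN1r (iter N Psi y)) addrC -iter_mean_linear scaleN1r addrC.
elim: N => //= N IH; exact: le_trans (nm_mean _) IH.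
Qed.

Lemma iter_mean1 N : iter N Psi 1 = 1.
Proof. by elim: N => //= N ->; rewrite mean1. Qed.

(* The mean only rotates a nonempty word, while dividing it by n >= 2. *)
Lemma iter_mean_rot N i al : exists j be,
  iter N Psi (Sw (i :: al)) = (n%:R^-1 ^+ N)%:C *: Sw (j :: be).
Proof.
elim: N => [|N [j [be IH]]]; first by exists i, al; rewrite expr0 scale1r.
have -> : iter N.+1 Psi (Sw (i :: al)) = (n%:R^-1 ^+ N.+1)%:C *: Sw (rcons be j).
  by rewrite iterS IH (iter_meanZ 1 _ _ : Psi _ = _ *: Psi _) /= mean_wordl scalerr exprSr cuntz_word_rcons.
by case: be {IH} => [|k be]; [exists j, [::] | exists k, (rcons be j)].
Qed.

(** On a monomial the mean strips equal heads at the price 1/n and kills unequal ones, until one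
    word is empty. What remains is then the unit, which is fixed, or a nonempty word or its adjoint,
    whose iterates tend to 0. *)
Lemma span_mean_tends x : cuntz_span x ->
  exists l : R[i], tends (fun N => iter N Psi x) l%:A.
Proof.
have small i al : tends (fun N => iter N Psi (Sw (i :: al))) 0.
  move=> e e0; have i1 : n%:R^-1 < 1 :> R by rewrite invf_lt1// ltr1n.
  have i0 : 0 <= n%:R^-1 :> R by rewrite invr_ge0 ltW.
  have [N hN] := geometric_small 1 i0 i1 e0.
  exists N => k /hN; rewrite mul1r subr0 => h; have [j [be ->]] := iter_mean_rot k i al.
  rewrite nmZr ger0_norm ?exprn_ge0//; apply: le_trans h.
  by rewrite ler_piMr ?exprn_ge0// nm_cuntz_word.
have smallstar i al : tends (fun N => iter N Psi (star (Sw (i :: al)))) 0.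
  rewrite -(star0 E); apply: (@tends_eq _ _ (fun N => star (iter N Psi (Sw (i :: al))))).
    by elim=> //= N <-; rewrite mean_star.
  exact: tends_star.
elim=> [||y z _ [l hl] _ [l' hl']|k y _ [l hl]].
- elim=> [[|j be]|i al IH [|j be]].
  + exists 1; rewrite scale1r /= star1 mulr1; apply: (@tends_eq _ _ (fun=> 1 : E)).
      by move=> N; rewrite iter_mean1.
    exact: tends_cst.
  + by exists 0; rewrite scale0r mul1r; apply: smallstar.
  + by exists 0; rewrite scale0r [star _]star1 mulr1; apply: small.
  + have [l hl] := IH be; exists (((i == j)%:R / n%:R)%:C * l).
    rewrite -scalerA => e e0; have [N hN] := tendsZ ((i == j)%:R / n%:R)%:C hl e0.
    (* One application of the mean is spent on stripping the two heads. *)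
    exists N.+1 => -[//|k] /hN; rewrite iterSr /=.
    by rewrite starMr mulrA -(mulrA (S i)) mean_word iter_meanZ.
- exists 0; rewrite scale0r; apply: (@tends_eq _ _ (fun=> 0 : E)); last exact: tends_cst.
  by move=> k; rewrite iter_mean0.
- exists (l + l'); rewrite scalerDl.
  apply: (@tends_eq _ _ (fun N => iter N Psi y + iter N Psi z)); last exact: tendsD.
  by move=> N; have := iter_mean_linear N 1 y z; rewrite !scale1r.
- exists (k * l); rewrite -scalerA.
  apply: (@tends_eq _ _ (fun N => k *: iter N Psi y)); last exact: tendsZ.
  by move=> N; rewrite iter_meanZ.
Qed.

Lemma cuntz_state : exists2 w : E -> R[i], is_state w &
  forall x, tends (fun N => iter N Psi x) (w x)%:A.
Proof.
have cv x : exists y, tends (fun N => iter N Psi x) y.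
  apply: (tends_dense iter_mean_lip (D := cuntz_span)); last exact: span_adh.
  by move=> y /span_mean_tends[l hl]; exists l%:A.
have [T hT] := choice cv.
have T_lip := tends_limit_lip iter_mean_lip hT.
(* An arbitrary state psi reads off the scalar: T x = psi(T x) 1 holds on the span and passes to its
   closure. *)
have [psi spsi _] := state_norming (star1 E).
have TE x : T x = (psi (T x))%:A.
  apply: (adh_eq (f := T) (g := fun x => (psi (T x))%:A) T_lip (L := 2)) (span_adh x).
    move=> y z; rewrite -scalerBl -(stateB spsi) nm_alg.
    by apply: le_trans (nm_state spsi _) _; have := T_lip y z; rewrite mul1r; lra.
  move=> y /span_mean_tends[l hl]; rewrite (tends_unique (hT y) hl).
  by rewrite (stateZ spsi) (state1 spsi) mulr1.
have TL (k : R[i]) x y : T (k *: x + y) = k *: T x + T y.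
  apply: (tends_unique (hT _)).
  apply: (@tends_eq _ _ (fun N => k *: iter N Psi x + iter N Psi y)).
    by move=> N; rewrite iter_mean_linear.
  by apply: tendsD => //; apply: tendsZ.
exists (fun x => psi (T x)); last by move=> x; rewrite -TE.
split=> [k x y|x|].
- by rewrite TL (stateDr spsi) (stateZ spsi).
- apply: (state_pos spsi); apply: pos_adh; apply: adh_tends (hT _) => N.
  by elim: N => [|N IH] /=; [apply: pos_star_mul | apply: mean_pos].
- have -> : T 1 = 1; last exact: state1.
  apply: (tends_unique (hT _)); apply: (@tends_eq _ _ (fun=> 1 : E)); last exact: tends_cst.
  by move=> N; rewrite iter_mean1.
Qed.

Section CuntzState.
Variable w : E -> R[i].
Hypothesis sw : is_state w.
Hypothesis hw : forall x, tends (fun N => iter N Psi x) (w x)%:A.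

(** Starting the iteration one step later does not change the limit. *)
Lemma cuntz_state_mean x : w (Psi x) = w x.
Proof.
have : (w (Psi x))%:A = (w x)%:A :> E.
  apply: (tends_unique (hw _)); apply: (@tends_eq _ _ (fun N => iter (N + 1) Psi x)).
    by move=> N; rewrite addn1 iterSr.
  exact: (tends_shift 1 (hw x)).
by move=> /(congr1 w); rewrite !(stateZ sw) (state1 sw) !mulr1.
Qed.

Lemma cuntz_stateS i x : w (S i * x) = n%:R^-1%:C * w (x * S i).
Proof. by rewrite -cuntz_state_mean mean_wordl (stateZ sw). Qed.

Lemma cuntz_state_starS i x : w (star (S i) * x) = n%:R%:C * w (x * star (S i)).
Proof.
rewrite -[x in LHS]starK -starMr (state_star sw).
have : w (S i * star x) = n%:R^-1%:C * w (star x * S i) := cuntz_stateS i (star x).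
move=> /(congr1 (fun z => n%:R%:C * z)).
rewrite mulrA -rmorphM /= divff ?gt_eqF// mul1r => <-.
have cR (t : R) z : conjc (t%:C * z) = t%:C * conjc z.
  by case: z => a b; apply/eqP; rewrite eq_complex /=; apply/andP; split; apply/eqP; ring.
by rewrite cR -(state_star sw) starMr starK.
Qed.

(** The factor is exp(- beta k) for beta = ln n and the gauge degree k = |al| - |be|; [kms_exists]
    matches it with the value of [entire_exp] at i beta. *)
Lemma cuntz_state_word al be x : w (Sw al * star (Sw be) * x) =
  (n%:R^-1 ^+ size al * n%:R ^+ size be)%:C * w (x * (Sw al * star (Sw be))).
Proof.
have hal y : w (Sw al * y) = (n%:R^-1 ^+ size al)%:C * w (y * Sw al).
  elim: al y => [|i al IH] y /=; first by rewrite expr0 !mul1r mulr1.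
  by rewrite -mulrA cuntz_stateS -mulrA IH mulrA -rmorphM /= exprS mulrA.
have hbe y : w (star (Sw be) * y) = (n%:R ^+ size be)%:C * w (y * star (Sw be)).
  elim: be y => [|i be IH] y /=; first by rewrite expr0 star1 !mul1r mulr1.
  by rewrite !starMr -mulrA IH -mulrA cuntz_state_starS mulrA -rmorphM /= exprSr !mulrA.
by rewrite -mulrA hal -mulrA hbe mulrA -rmorphM /= mulrA.
Qed.

End CuntzState.

End CuntzWords.

(** * The gauge flow, its degree 1 projection and KMS states *)

Section Gauge.
Variables (R : realType) (n : nat) (E : cstarAlgType R) (S : 'I_n -> E).
Hypothesis cS : cuntz_family S.
Hypothesis gS : cstar_generated (range S) = setT.
Hypothesis n2 : (2 <= n)%N.
Variable g : R[i] -> E -> E.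
Hypothesis g_hom : forall z : R[i], `|z| = 1 -> star_hom (g z).
Hypothesis g_S : forall z : R[i], `|z| = 1 -> forall i, g z (S i) = z *: S i.
Implicit Types (x y a b : E) (al be m : seq 'I_n) (t s beta : R).

Local Notation flow := (gauge_flow g).
Local Notation Sw := (cuntz_word S).
Local Notation span := (cuntz_span S).

Lemma flow_hom t : star_hom (flow t).
Proof. exact/g_hom/cis_norm. Qed.

Lemma flow_S t i : flow t (S i) = cis t *: S i.
Proof. exact/g_S/cis_norm. Qed.

Lemma flow_word t m : flow t (Sw m) = cis (t * (size m)%:R) *: Sw m.
Proof.
elim: m => [|i m IH] /=; first by rewrite (star_hom_one (flow_hom t)) mulr0 cis0 scale1r.
rewrite (star_homM (flow_hom t)) flow_S IH -scalerAl -scalerAr scalerA -cisD.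
by rewrite -natr1 mulrDr mulr1 addrC.
Qed.

Lemma flow_mono t al be : flow t (Sw al * star (Sw be)) =
  cis (t * ((size al)%:R - (size be)%:R)) *: (Sw al * star (Sw be)).
Proof.
rewrite (star_homM (flow_hom t)) (star_homS (flow_hom t)) !flow_word starZc cisN_conj.
by rewrite -scalerAl -scalerAr scalerA -cisD mulrBr.
Qed.

Lemma flow_comm t s x : flow t (flow s x) = flow s (flow t x).
Proof.
apply: (star_hom_generated_eq (f := flow t \o flow s) (g := flow s \o flow t) gS).
- exact: star_hom_comp (flow_hom s) (flow_hom t).
- exact: star_hom_comp (flow_hom t) (flow_hom s).
- move=> _ [i _ <-] /=.
  by rewrite !flow_S !(star_homZ (flow_hom _)) !flow_S !scalerA mulrC.
Qed.

Lemma flow_span t x : span x -> span (flow t x).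
Proof.
elim=> [al be||y z _ hy _ hz|k y _ hy].
- by rewrite flow_mono; apply/spanZ/span_word.
- by rewrite (star_hom0 (flow_hom t)); apply: span0.
- by rewrite (star_homD (flow_hom t)); apply: spanD.
- by rewrite (star_homZ (flow_hom t)); apply: spanZ.
Qed.

Let n0 : 0 < n%:R :> R.
Proof. by rewrite ltr0n (leq_trans _ n2). Qed.

Lemma kms_exists (w : E -> R[i]) : is_state w ->
  (forall x, tends (fun N => iter N (cuntz_mean S) x) (w x)%:A) ->
  is_kms flow (ln n%:R) w.
Proof.
move=> sw hw; split => //; exists span; split.
- exact: span_star_subalgebra.
- by apply/dense_adh => x; apply: span_adh.
- by move=> t a; apply: flow_span.
(* Strengthened to all a in E, so that the induction on b does not involve the domain of a. *)
move=> b hb; suff [f hf hk] : exists2 f, entire_extension flow b f &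
    forall a, w (a * f (0 +i* ln n%:R)) = w (b * a) by exists f.
elim: hb => [al be||x y _ [f [ef ff] hf] _ [h [eh hh'] hh]|k x _ [f [ef ff] hf]].
- pose k : R := (size al)%:R - (size be)%:R.
  have [f [ef ft fi]] := entire_exp k (Sw al * star (Sw be)); exists f.
    by split=> // t; rewrite ft flow_mono.
  move=> a; rewrite fi -scalerAr (stateZ sw) (cuntz_state_word cS n2 sw hw); congr (_%:C * _).
  rewrite /k mulrBr opprB expRB !expRM_natr lnK ?posrE//.
  by rewrite exprVn mulrC.
- have [f [ef ft fi]] := entire_exp 0 (0 : E); exists f.
    by split=> // t; rewrite ft scaler0 (star_hom0 (flow_hom t)).
  by move=> a; rewrite fi scaler0 mulr0 mul0r.
- exists (fun z => 1 *: f z + h z).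
    split; first exact: entire_lin.
    by move=> t; rewrite ff hh' scale1r (star_homD (flow_hom t)).
  by move=> a; rewrite scale1r mulrDr mulrDl !(stateDr sw) hf hh.
(* The multiple k f, in a shape obtained by applying [entire_lin] twice. *)
- exists (fun z => k *: f z + f z - f z); last first.
    by move=> a; rewrite addrK -scalerAr -scalerAl !(stateZ sw) hf.
  have E1 : (fun z => k *: f z + f z - f z) = (fun z => -1 *: f z + (k *: f z + f z)).
    by apply/funext => z; rewrite scaleN1r addrC.
  split; first by rewrite E1; apply: entire_lin => //; apply: entire_lin.
  by move=> t; rewrite addrK ff (star_homZ (flow_hom t)).
Qed.

Definition dyadic_angle j : R := pi / 2 ^+ j.
(* The composition of these averages converges to the projection onto the
   elements of gauge degree 1: the j-th one annihilates the degrees k for which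
   k - 1 is an odd multiple of 2 ^ j. *)
Definition half_average j x := 2^-1%:C *: (x + cis (- dyadic_angle j) *: flow (dyadic_angle j) x).
Definition average N x := foldl (fun y j => half_average j y) x (iota 0 N).

Lemma averageS N x : average N.+1 x = half_average N (average N x).
Proof. by rewrite /average -addn1 iotaD foldl_cat. Qed.

Lemma average_linear N (k : R[i]) x y : average N (k *: x + y) = k *: average N x + average N y.
Proof.
elim: N => // N IH; rewrite !averageS IH /half_average.
rewrite (star_homD (flow_hom _)) (star_homZ (flow_hom _)).
move: (average N x) (average N y) => u v.
move: (cis _) (flow _ u) (flow _ v) => c u' v'.
rewrite (scalerA k) (mulrC k) -(scalerA _ k) -scalerDr; congr (_ *: _).
by rewrite !scalerDr !scalerA (mulrC c) addrACA.
Qed.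

Lemma average0 N : average N 0 = 0.
Proof. by have := average_linear N (-1) 0 0; rewrite scaler0 addr0 scaleN1r addNr. Qed.

Lemma averageZ N (k : R[i]) x : average N (k *: x) = k *: average N x.
Proof. by have := average_linear N k x 0; rewrite average0 !addr0. Qed.

Lemma averageD N x y : average N (x + y) = average N x + average N y.
Proof. by have := average_linear N 1 x y; rewrite !scale1r. Qed.

Lemma average_lip N x y : nm (average N x - average N y) <= 1 * nm (x - y).
Proof.
rewrite mul1r -(scaleN1r (average N y)) addrC -average_linear scaleN1r addrC.
move: (x - y) => {x y} x; elim: N => // N IH; rewrite averageS /half_average.
rewrite nmZr ger0_norm//; move: (average N x) IH => y IH.
have := nmD y (cis (- dyadic_angle N) *: flow (dyadic_angle N) y).
rewrite nmZ nm_cis mul1r; have := nm_star_hom y (flow_hom (dyadic_angle N)); lra.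
Qed.

(** Here the flow-invariance of the KMS domain enters: averages of its elements stay in it, although
    their limit may leave it. *)
Lemma average_closed (D : set E) N x : star_subalgebra D -> (forall t a, D a -> D (flow t a)) ->
  D x -> D (average N x).
Proof.
move=> sD hD Dx; elim: N => // N IH; rewrite averageS.
by apply/(star_subalgebraZ sD)/(star_subalgebraD sD) => //; apply/(star_subalgebraZ sD)/hD.
Qed.

Lemma average_flow N t x : average N (flow t x) = flow t (average N x).
Proof.
elim: N => // N IH; rewrite !averageS IH /half_average flow_comm.
by rewrite (star_homZ (flow_hom _)) (star_homD (flow_hom _)) (star_homZ (flow_hom _)).
Qed.

Lemma half_average_eigen j (k : R) x : flow (dyadic_angle j) x = cis (dyadic_angle j * k) *: x ->
  half_average j x = (2^-1%:C * (1 + cis (dyadic_angle j * (k - 1)))) *: x.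
Proof.
move=> h; rewrite /half_average h scalerA -cisD -{1}[x]scale1r -scalerDl scalerA.
by congr ((_ * (_ + cis _)) *: _); ring.
Qed.

Lemma average_eigen1 N x : (forall t, flow t x = cis t *: x) -> average N x = x.
Proof.
move=> h; elim: N => // N IH; rewrite averageS IH (@half_average_eigen _ 1) ?mulr1//.
rewrite subrr mulr0 cis0 -(rmorph1 (real_complex R)) -rmorphD -rmorphM /=.
by rewrite (_ : 2^-1 * (1 + 1) = 1) ?scale1r//; field.
Qed.

Lemma average_mono_tends al be : exists l, tends (fun N => average N (Sw al * star (Sw be))) l
  /\ forall t, flow t l = cis t *: l.
Proof.
set x := Sw al * star (Sw be).
have hx t : flow t x = cis (t * ((size al)%:R - (size be)%:R)) *: x by apply: flow_mono.
have [e|ne] := eqVneq (size al) (size be).+1.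
  have hx1 t : flow t x = cis t *: x by rewrite hx e -natr1 addrAC subrr add0r mulr1.
  exists x; split => //; apply: (@tends_eq _ _ (fun=> x)); last exact: tends_cst.
  by move=> N; rewrite average_eigen1.
exists 0; split; last by move=> t; rewrite scaler0 (star_hom0 (flow_hom t)).
(* The degree minus 1 is nonzero here, and its 2-adic valuation a is the index of the average that
   annihilates [x]: [dyadic_angle a] times it is an odd multiple of pi. *)
have [a [b [ob hab]]] : exists a b : nat, odd b /\
    ((size al)%:R - (size be)%:R - 1 = 2 ^+ a * b%:R :> R \/
     (size al)%:R - (size be)%:R - 1 = - (2 ^+ a * b%:R) :> R).
  have dec k : (0 < k)%N -> exists a b : nat, odd b /\ k = (2 ^ a * b)%N.
    move=> k0; have [b ob hk] := @pfactor_coprime 2 k isT k0.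
    exists (logn 2 k), b; split; last by rewrite mulnC.
    by rewrite coprime2n in ob.
  have [lt|lt] := ltnP (size be).+1 (size al).
    have k0 : (0 < size al - (size be).+1)%N by rewrite subn_gt0.
    have [a [b [ob hk]]] := dec _ k0; exists a, b; split => //; left.
    by rewrite -natrX -natrM -hk natrB ?(ltnW lt)// -natr1; ring.
  have k0 : (0 < (size be).+1 - size al)%N by rewrite subn_gt0 ltn_neqAle ne.
  have [a [b [ob hk]]] := dec _ k0; exists a, b; split => //; right.
  by rewrite -natrX -natrM -hk natrB// -natr1; ring.
have az N : exists c, average N x = c *: x.
  elim: N => [|N [c IH]]; first by exists 1; rewrite scale1r.
  rewrite averageS IH; eexists; rewrite (@half_average_eigen _ ((size al)%:R - (size be)%:R)).
    by rewrite scalerA.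
  by rewrite (star_homZ (flow_hom _)) hx !scalerA mulrC.
have a0 : average a.+1 x = 0.
  rewrite averageS; have [c ->] := az a.
  rewrite (@half_average_eigen _ ((size al)%:R - (size be)%:R)); last first.
    by rewrite (star_homZ (flow_hom _)) hx !scalerA mulrC.
  rewrite (_ : cis _ = -1) ?subrr ?mulr0 ?scale0r//.
  have ta : (2 ^+ a : R) != 0 by rewrite expf_neq0.
  have ang : dyadic_angle a * (2 ^+ a * b%:R) = pi * b%:R by rewrite /dyadic_angle; field.
  have [->|->] := hab; rewrite ?mulrN ang; first exact: cis_pi_odd.
  by rewrite -cisN_conj cis_pi_odd//; apply/eqP; rewrite eq_complex /= !oppr0 !eqxx.
move=> e e0; exists a.+1 => N aN; rewrite subr0.
suff -> : average N x = 0 by rewrite nm0 ltW.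
rewrite -(subnKC aN); elim: (N - a.+1)%N => [|j IH]; first by rewrite addn0.
by rewrite addnS averageS IH /half_average (star_hom0 (flow_hom _)) scaler0 addr0 scaler0.
Qed.

(** P stands for the mean of exp(- i t) flow_t over a period. On a monomial the averages are
    eventually constant, and their uniform Lipschitz bound extends convergence to all of E. *)
Lemma spectral_projection : exists P : E -> E,
  (forall x, tends (fun N => average N x) (P x)) /\ forall t x, flow t (P x) = cis t *: P x.
Proof.
have cvs x : span x -> exists l, tends (fun N => average N x) l /\ forall t, flow t l = cis t *: l.
  elim=> [al be||y z _ [l [hl fl]] _ [l' [hl' fl']]|k y _ [l [hl fl]]].
  - exact: average_mono_tends.
  - exists 0; split; last by move=> t; rewrite (star_hom0 (flow_hom t)) scaler0.
    apply: (@tends_eq _ _ (fun=> 0 : E)); last exact: tends_cst.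
    by move=> N; rewrite average0.
  - exists (l + l'); split.
      apply: (@tends_eq _ _ (fun N => average N y + average N z)); last exact: tendsD.
      by move=> N; rewrite averageD.
    by move=> t; rewrite (star_homD (flow_hom t)) fl fl' scalerDr.
  - exists (k *: l); split.
      apply: (@tends_eq _ _ (fun N => k *: average N y)); last exact: tendsZ.
      by move=> N; rewrite averageZ.
    by move=> t; rewrite (star_homZ (flow_hom t)) fl !scalerA mulrC.
have cv x : exists y, tends (fun N => average N x) y.
  apply: (tends_dense average_lip (D := span)); last exact: span_adh.
  by move=> y /cvs[l [hl _]]; exists l.
have [P hP] := choice cv; exists P; split => // t x.
have P_lip := tends_limit_lip average_lip hP.
apply: (adh_eq (f := fun x => flow t (P x)) (g := fun x => cis t *: P x)
  (K := 1) (L := 1) _ _ _ (span_adh cS gS x)) => [y z|y z|y /cvs[l [hl fl]]].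
- by apply: le_trans (star_hom_lip _ _ (flow_hom t)) _; rewrite mul1r.
- by rewrite -scalerBr nmZ nm_cis mul1r.
- by rewrite (tends_unique (hP y) hl).
Qed.

(* The degree 1 part of the entire extension of the flow of b is exp(iz) times
   the degree 1 part of b, by uniqueness of entire extensions; so the KMS
   condition on the given domain passes to the elements of degree 1. *)
Lemma kms_relation (w : E -> R[i]) beta : is_kms flow beta w ->
  forall i a, w (S i * a) = (expR (- beta))%:C * w (a * S i).
Proof.
move=> [sw [D [sD dD fD hD]]].
have [P [hP fP]] := spectral_projection.
have w_lip x y : nm (w x - w y) <= 2 * nm (x - y).
  by rewrite -(stateB sw); apply: le_trans (nm_state sw _) _; lra.
have tends_w u x : tends u x -> @tends R (R[i]^o : normedModType R[i]) (w \o u) (w x).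
  by apply: (@tends_lip R E (R[i]^o : normedModType R[i]) w 2).
have P_lip := tends_limit_lip average_lip hP.
have PD x y : P (x + y) = P x + P y.
  apply: (tends_unique (hP _)); apply: (@tends_eq _ _ (fun N => average N x + average N y)).
    by move=> N; rewrite averageD.
  exact: tendsD.
have PZ (k : R[i]) x : P (k *: x) = k *: P x.
  apply: (tends_unique (hP _)); apply: (@tends_eq _ _ (fun N => k *: average N x)).
    by move=> N; rewrite averageZ.
  exact: tendsZ.
have Pflow t x : P (flow t x) = cis t *: P x.
  rewrite -fP; apply: (tends_unique (hP _)).
  apply: (@tends_eq _ _ (fun N => flow t (average N x))).
    by move=> N; rewrite average_flow.
  by apply: tends_lip (hP x) => y z; apply: star_hom_lip (flow_hom t).
have key b a : D b -> D a -> (expR (- beta))%:C * w (a * P b) = w (P b * a).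
  move=> Db Da; have [f [ef ff] _] := hD b Db.
  have avg N : w (a * average N (f (0 +i* beta))) = w (average N b * a).
    (* Both [h] and [average N \o f] are entire extensions of the flow of [average N b], so they
       agree at i beta. *)
    have [h [eh hh] hk] := hD _ (average_closed N sD fD Db).
    rewrite -hk//; congr (w (a * _)).
    apply: (entire_unique (f := average N \o f)) => [||t] //=.
      by apply: entire_comp ef; [exact: averageD | exact: averageZ | exact: average_lip].
    by rewrite ff hh average_flow.
  have Pf : P (f (0 +i* beta)) = (expR (- beta))%:C *: P b.
    have [h [eh ht hi]] := entire_exp 1 (P b).
    rewrite -[beta in RHS]mulr1 -hi.
    apply: (entire_unique (f := P \o f)) => [||t] //=.
      by apply: entire_comp ef; [exact: PD | exact: PZ | exact: P_lip].
    by rewrite ff Pflow ht mulr1.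
  have : w (a * P (f (0 +i* beta))) = w (P b * a).
    apply: (@tends_unique _ (R[i]^o : normedModType R[i])
      (fun N => w (a * average N (f (0 +i* beta))))).
      by apply: tends_w _; apply: tendsM (hP _); apply: tends_cst.
    apply: (@tends_eq _ (R[i]^o : normedModType R[i]) (fun N => w (average N b * a))); first by move=> N; rewrite avg.
    by apply: tends_w _; apply: tendsM (hP _) _; apply: tends_cst.
  by rewrite Pf -scalerAr (stateZ sw).
move=> i a.
have aD x : adh D x by move/dense_adh: dD.
have [u Du ua] := adh_seq (aD a); have [v Dv vS] := adh_seq (aD (S i)).
(* Since S_i is its own degree 1 part, it is the limit of the P (v N) with v N in D, to which [key]
   applies; continuity of w closes the argument. *)
have PS : P (S i) = S i.
  apply: (tends_unique (hP _)); apply: (@tends_eq _ _ (fun=> S i)); last exact: tends_cst.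
  by move=> N; rewrite average_eigen1// => t; apply: flow_S.
have vP : tends (fun N => P (v N)) (S i) by rewrite -PS; apply: tends_lip P_lip vS.
apply: (@tends_unique _ (R[i]^o : normedModType R[i]) (fun N => w (P (v N) * u N))).
  by apply: tends_w _; apply: tendsM.
apply: (@tends_eq _ (R[i]^o : normedModType R[i])
  (fun N => (expR (- beta))%:C *: (w (u N * P (v N)) : R[i]^o))).
  by move=> N; rewrite -key.
by apply: tendsZ; apply: tends_w _; apply: tendsM.
Qed.

Lemma kms_unique (w w' : E -> R[i]) beta : is_state w ->
  (forall x, tends (fun N => iter N (cuntz_mean S) x) (w x)%:A) ->
  is_kms flow beta w' -> beta = ln n%:R /\ w' = w.
Proof.
move=> sw hw hk; have rel := kms_relation hk; have [sw' _] := hk.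
(* Evaluate w' on the n summands of 1, each of value exp(- beta) by the relation and the isometry
   property. *)
have nb : n%:R * expR (- beta) = 1.
  apply: complexI; rewrite -[RHS](state1 sw') -(sum_S_star cS).
  rewrite (big_morph w' (stateDr sw') (state0 sw')).
  rewrite (eq_bigr (fun=> (expR (- beta))%:C)) => [|i _].
    by rewrite sumr_const card_ord rmorphM rmorph_nat mulr_natl.
  by rewrite rel (star_mul1S cS) (state1 sw') mulr1.
have eb : expR (- beta) = n%:R^-1.
  by apply: (mulfI (lt0r_neq0 n0)); rewrite nb divff ?gt_eqF.
split.
  have -> : n%:R = expR beta by rewrite -[LHS]invrK -eb expRN invrK.
  by rewrite expRK.
have inv x : w' (cuntz_mean S x) = w' x.
  rewrite /cuntz_mean (stateZ sw') (big_morph w' (stateDr sw') (state0 sw')).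
  rewrite -[x in RHS]mul1r -(sum_S_star cS) mulr_suml.
  rewrite (big_morph w' (stateDr sw') (state0 sw')) mulr_sumr.
  by apply: eq_bigr => i _; rewrite -(mulrA (S i)) rel eb.
apply/funext => x.
have invN N : w' (iter N (cuntz_mean S) x) = w' x by elim: N => //= N <-; rewrite inv.
have -> : w x = w' (w x)%:A by rewrite (stateZ sw') (state1 sw') mulr1.
apply: (@tends_unique _ (R[i]^o : normedModType R[i]) (fun N => w' (iter N (cuntz_mean S) x))).
  by apply: (@tends_eq _ (R[i]^o : normedModType R[i]) (fun=> w' x)) => [N|]; [rewrite invN | exact: tends_cst].
apply: (@tends_lip R E (R[i]^o : normedModType R[i]) w' 2) (hw x) => y z.
by rewrite -(stateB sw'); apply: le_trans (nm_state sw' _) _; lra.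
Qed.

End Gauge.

Theorem proposition4p10 (R : realType) (A B : cstarAlgType R)
  (la : A -> B -> B) (ra : B -> A -> B) (hB : banach_bimodule la ra)
  (Dom : set A) (delta : A -> B)
  (hdelta : star_derivation la ra Dom delta)
  (hker : [set a | Dom a /\ delta a = 0] = range (fun k : R[i] => k%:A : A))
  (hbounded : exists M : R, forall a,
     lipschitz_ball Dom delta a -> quotient_norm a <= M)
  (d : nat) (hd : (2 <= d)%N)
  (phi : 'I_d -> A -> A) (hphi : forall i, star_hom (phi i))
  (hcontr : forall i, proper_contraction Dom delta (fun w => w \o phi i))
  (E : cstarAlgType R) (p : A -> E) (S : 'I_d -> E)
  (hE : is_crossed_product phi p S)
  (g : R[i] -> E -> E) (hg : is_gauge_action p S g) :
  [/\ cstar_generated (range S) = setT,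
      forall (O : cstarAlgType R) (s : 'I_d -> O), is_cuntz_algebra s ->
        exists h : O -> E,
          [/\ star_hom h, bijective h & forall i, h (s i) = S i]
    & exists w : E -> R[i], is_kms (gauge_flow g) (ln d%:R) w /\
        forall (beta : R) (w' : E -> R[i]),
          is_kms (gauge_flow g) beta w' -> beta = ln d%:R /\ w' = w].
Proof.
(* A reference state, used to choose the scalars near phi_m(a); which one is immaterial. *)
have [sw0 hsw0] : exists w0 : A -> R[i], is_state w0.
  by have [w0 sw0 _] := state_norming (star1 A); exists w0.
have hnear := near_scalar_all hdelta hbounded hphi hcontr hsw0.
have [hcov gE univ] := hE; have cS := covariant_cuntz hcov.
have hp := covariant_hom hcov.
have genE : cstar_generated (range S) = setT.
  apply/seteqP; split => // x _.
  have GX := cstar_generated_star_subalgebra (range S).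
  (* A [star_subalgebra] need not contain 1 by definition; here the sum relation provides it. *)
  have G1 : cstar_generated (range S) 1.
    rewrite -(cuntz_sum cS); apply: big_ind; first exact: star_subalgebra0.
      exact: (star_subalgebraD GX).
    move=> i _; have Si : cstar_generated (range S) (S i).
      by apply: sub_cstar_generated; exists i.
    by apply: (star_subalgebraM GX) => //; apply: (star_subalgebra_star GX).
  apply: (cstar_generated_min gE GX (@cstar_generated_adh _ _ _)).
  move=> _ [[a _ <-]|[i _ <-]]; last by apply: sub_cstar_generated; exists i.
  apply: cstar_generated_adh; apply: adh_tends (covariant_approx hnear cS a hcov) => k.
  elim: k a => [|k IH] a /=; first exact: (star_subalgebraZ GX).
  apply: big_ind; [exact: star_subalgebra0 | exact: (star_subalgebraD GX) |].
  move=> i _; have Si : cstar_generated (range S) (S i).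
    by apply: sub_cstar_generated; exists i.
  apply: (star_subalgebraM GX); last exact: (star_subalgebra_star GX).
  exact: (star_subalgebraM GX).
split=> [//|O s hs|].
- have cs := cuntz_relations hs.
  have [q [hq _ qs]] := cuntz_realization hphi hsw0 hnear cs.
  have [h hh hS] := cuntz_universal hs cS.
  have [h' [hh' _ h's]] := univ O q s (CovariantPair hq cs qs).
  (* Both composites fix the isometries, which generate O by assumption and E by [genE], so both are
     identities. *)
  exists h; split => //; exists h' => x.
    apply: (star_hom_generated_eq (f := h' \o h) (g := idfun) (cuntz_generated hs)) => //.
    - exact: star_hom_comp.
    - by move=> _ [i _ <-] /=; rewrite hS h's.
  apply: (star_hom_generated_eq (f := h \o h') (g := idfun) genE) => //.
  - exact: star_hom_comp.
  - by move=> _ [i _ <-] /=; rewrite h's hS.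
- have [w sw hw] := cuntz_state cS genE hd.
  have gh := gauge_hom hg; have gs := gauge_gen hg.
  exists w; split; first exact (kms_exists cS genE hd gh gs sw hw).
  by move=> beta w' hk; exact (kms_unique cS genE hd gh gs sw hw hk).
Qed.
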